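(* A subcategory $\mathcal{A}\subseteq\mathcal{C}_2$ is maximal almost rigid if and only if the set of arcs corresponding to its indecomposable objects is a triangulation of the completed $\infty$-gon.
   Context: Let $R=\mathbb{C}[x,y]/(x^2)$, graded with $\deg x=1$, $\deg y=-1$; $M(j)$ denotes the graded module with $M(j)_n=M_{j+n}$. Let $\mathcal{C}_2$ be the exact (Frobenius) category of finitely generated $\mathbb{Z}$-graded maximal Cohen–Macaulay $R$-modules with degree-preserving morphisms. Every indecomposable object of $\mathcal{C}_2$ is isomorphic to exactly one of $(x,y^k)(j)$ ($k\in\mathbb{Z}_{\ge0}$, $j\in\mathbb{Z}$, with $(x,y^0)=R$) or $\mathbb{C}[y](j)=(R/(x))(j)$ ($j\in\mathbb{Z}$). An arc of the completed $\infty$-gon is a pair $(a,b)$ with $a\in\mathbb{Z}\cup\{-\infty\}$, $b\in\mathbb{Z}$, $a<b$; it is finite if $a\in\mathbb{Z}$ and infinite if $a=-\infty$. Indecomposables are identified with arcs via $(x,y^k)(j)\leftrightarrow(-j-k,1-j)$ and $\mathbb{C}[y](j)\leftrightarrow(-\infty,-j)$. Two arcs $(a,b),(c,d)$ cross if $a<c<b<d$ or $c<a<d<b$. A triangulation of the completed $\infty$-gon is a maximal set of pairwise non-crossing arcs. Subcategories are full, additive and closed under isomorphisms and direct summands. Two indecomposables $M,N$ are almost compatible if there are no non-split extensions between them (in either direction), or all non-split extensions between them have indecomposable middle terms. A subcategory $\mathcal{A}$ is almost rigid if any two indecomposables in $\mathcal{A}$ are almost compatible, and maximal almost rigid if it is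 almost rigid and for every module $M\notin\mathcal{A}$, $\mathrm{add}(\mathcal{A}\cup M)$ is not almost rigid. *)

(* Defs.v *)
From HB Require Import structures.
From mathcomp Require Import all_boot all_order all_algebra.
From mathcomp Require Import complex Rstruct.
Set Implicit Arguments. Unset Strict Implicit. Unset Printing Implicit Defensive.
Import Order.TTheory GRing.Theory Num.Theory.
Local Open Scope ring_scope.

Definition CC : fieldType := complex Rdefinitions.R.

(** * Z-graded modules over R = C[x,y]/(x^2), deg x = 1, deg y = -1.
    A graded R-module is given by its homogeneous components M_n (C-vector
    spaces, n : int) together with the action of x : M_n -> M_{n+1} and
    of y : M_{n+1} -> M_n (a graded module over C[x,y] is exactly such data
    with xy = yx; the relation x^2 = 0 makes it an R-module).  *)
Record GrData := GrDatum {
  gV : int -> lmodType CC;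
  gx : forall n : int, gV n -> gV (n + 1);
  gy : forall n : int, gV (n + 1) -> gV n }.

Definition lin (U W : lmodType CC) (f : U -> W) : Prop :=
  forall (a : CC) (u v : U), f (a *: u + v) = a *: f u + f v.

Definition is_grmod (M : GrData) : Prop :=
  [/\ forall n, lin (@gx M n), forall n, lin (@gy M n),
      forall n (v : gV M n), gx (gx v) = 0
    & forall n (v : gV M (n + 1)), gy (gx v) = gx (gy v)].

Definition graded_submodule (M : GrData) (S : forall n, gV M n -> Prop) :=
  [/\ forall n, S n 0,
      forall n (a : CC) (u v : gV M n), S n u -> S n v -> S n (a *: u + v),
      forall n (u : gV M n), S n u -> S (n + 1) (gx u)
    & forall n (u : gV M (n + 1)), S (n + 1) u -> S n (gy u)].

Definition fin_gen (M : GrData) : Prop :=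
  exists gens : seq {n : int & gV M n},
    forall S : forall n, gV M n -> Prop,
      graded_submodule S ->
      (forall g, List.In g gens -> S (projT1 g) (projT2 g)) ->
      forall n (v : gV M n), S n v.

(** Maximal Cohen-Macaulay (R is graded of Krull dimension 1): M = 0 or
    depth M >= 1 w.r.t. the graded maximal ideal (x,y), i.e. no nonzero
    element of M is annihilated by both x and y (Hom_R(C, M) = 0). *)
Definition is_MCM (M : GrData) : Prop :=
  forall n (v : gV M (n + 1)), gx v = 0 -> gy v = 0 -> v = 0.

Definition C2obj (M : GrData) : Prop := [/\ is_grmod M, fin_gen M & is_MCM M].

Definition is_hom (M N : GrData) (f : forall n, gV M n -> gV N n) : Prop :=
  [/\ forall n, lin (f n),
      forall n (v : gV M n), f (n + 1) (gx v) = gx (f n v)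
    & forall n (v : gV M (n + 1)), f n (gy v) = gy (f (n + 1) v)].

Definition iso (M N : GrData) : Prop :=
  exists (f : forall n, gV M n -> gV N n) (g : forall n, gV N n -> gV M n),
    [/\ is_hom f, is_hom g, (forall n v, g n (f n v) = v)
      & (forall n w, f n (g n w) = w)].

Definition is_zero (M : GrData) : Prop := forall n (v : gV M n), v = 0.

Definition dsum (M N : GrData) : GrData :=
  @GrDatum (fun n => ((gV M n * gV N n)%type : lmodType CC))
    (fun n v => (gx v.1, gx v.2)) (fun n v => (gy v.1, gy v.2)).

Definition indecomposable (M : GrData) : Prop :=
  [/\ C2obj M, ~ is_zero M &
      forall A B, C2obj A -> C2obj B -> iso M (dsum A B) -> is_zero A \/ is_zero B].

Definition conflation (M E N : GrData) (f : forall n, gV M n -> gV E n)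
  (g : forall n, gV E n -> gV N n) : Prop :=
  [/\ C2obj E, is_hom f /\ is_hom g,
      forall n, injective (f n),
      forall n (w : gV N n), exists v, g n v = w
    & forall n (v : gV E n), g n v = 0 <-> exists u, f n u = v].

Definition split_epi (E N : GrData) (g : forall n, gV E n -> gV N n) : Prop :=
  exists s : forall n, gV N n -> gV E n, is_hom s /\ forall n w, g n (s n w) = w.

Definition no_nonsplit_ext (M N : GrData) : Prop :=
  forall E f g, @conflation M E N f g -> split_epi g.
Definition nonsplit_ext_indec (M N : GrData) : Prop :=
  forall E f g, @conflation M E N f g -> ~ split_epi g -> indecomposable E.

Definition almost_compatible (M N : GrData) : Prop :=
  (no_nonsplit_ext M N /\ no_nonsplit_ext N M) \/
  (nonsplit_ext_indec M N /\ nonsplit_ext_indec N M).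

(** Subcategories of C_2: full, additive, closed under isomorphisms and
    direct summands; represented by the predicate of their objects. *)
Definition subcategory (A : GrData -> Prop) : Prop :=
  [/\ forall X, A X -> C2obj X,
      exists Z, A Z /\ is_zero Z,
      forall X Y, A X -> C2obj Y -> iso X Y -> A Y,
      forall X Y, A X -> A Y -> A (dsum X Y)
    & forall X Y Z, A X -> C2obj Y -> C2obj Z -> iso X (dsum Y Z) -> A Y /\ A Z].

Definition add_with (A : GrData -> Prop) (M : GrData) : GrData -> Prop :=
  fun X => forall B, subcategory B -> (forall Y, A Y -> B Y) -> B M -> B X.

Definition almost_rigid (A : GrData -> Prop) : Prop :=
  forall M N, A M -> A N -> indecomposable M -> indecomposable N ->
    almost_compatible M N.

Definition maximal_almost_rigid (A : GrData -> Prop) : Prop :=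
  almost_rigid A /\
  forall M, C2obj M -> ~ A M -> ~ almost_rigid (add_with A M).

(** * The modules (x,y^k)(j) and C[y](j).
    Homogeneous component n of (x,y^k)(j) is the component j+n of the ideal
    (x,y^k) of R, with basis  [x y^(1-j-n)] (present iff j+n <= 1) followed
    by [y^(-j-n)] (present iff j+n <= -k).  Component n of C[y](j) = R/(x)(j)
    has basis [y^(-j-n)] (present iff j+n <= 0).  Elements are row vectors. *)
Definition pat_x (m p : nat) : 'M[CC]_(m, p) :=
  \matrix_(i, l) (((i : nat) == 1%N) && ((l : nat) == 0%N))%:R.
Definition pat_id (m p : nat) : 'M[CC]_(m, p) :=
  \matrix_(i, l) ((i : nat) == (l : nat))%:R.

Definition dimI (k : nat) (j n : int) : nat :=
  (nat_of_bool (j + n <= 1)%R + nat_of_bool (j + n <= - (k%:Z))%R)%N.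

Definition IdealMod (k : nat) (j : int) : GrData :=
  @GrDatum (fun n => ('rV[CC]_(dimI k j n) : lmodType CC))
    (fun n v => v *m pat_x (dimI k j n) (dimI k j (n + 1)))
    (fun n v => v *m pat_id (dimI k j (n + 1)) (dimI k j n)).

Definition dimC (j n : int) : nat := nat_of_bool (j + n <= 0)%R.

Definition CyMod (j : int) : GrData :=
  @GrDatum (fun n => ('rV[CC]_(dimC j n) : lmodType CC))
    (fun n v => 0)
    (fun n v => v *m pat_id (dimC j (n + 1)) (dimC j n)).

(** * Arcs of the completed infinity-gon.  None stands for -oo. *)
Definition arc := (option int * int)%type.

Definition lt_end (a b : option int) : bool :=
  match a, b with
  | None, Some _ => true
  | Some x, Some y => x < y
  | _, _ => false
  end.

Definition valid_arc (al : arc) : bool := lt_end al.1 (Some al.2).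

Definition cross (al be : arc) : bool :=
  let: (a, b) := al in let: (c, d) := be in
  (lt_end a c && lt_end c (Some b) && (b < d)) ||
  (lt_end c a && lt_end a (Some d) && (d < b)).

Definition noncrossing_set (T : arc -> Prop) : Prop :=
  forall al be, T al -> T be -> ~~ cross al be.

Definition triangulation (T : arc -> Prop) : Prop :=
  [/\ forall al, T al -> valid_arc al,
      noncrossing_set T
    & forall al, valid_arc al -> ~ T al ->
        ~ noncrossing_set (fun be => T be \/ be = al)].

Definition corresponds (M : GrData) (al : arc) : Prop :=
  match al with
  | (Some a, b) => exists (k : nat) (j : int),
      a = - j - k%:Z /\ b = 1 - j /\ iso M (IdealMod k j)
  | (None, b) => exists j : int, b = - j /\ iso M (CyMod j)
  end.

Definition arcs_of (A : GrData -> Prop) : arc -> Prop :=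
  fun al => valid_arc al /\ exists M, A M /\ indecomposable M /\ corresponds M al.

(* Main.v *)
Require Import Defs.
From HB Require Import structures.
From mathcomp Require Import all_boot all_order all_algebra.
From mathcomp Require Import complex Rstruct.
From Stdlib Require Import Classical ClassicalEpsilon.
From mathcomp Require Import zify ring.
Set Implicit Arguments. Unset Strict Implicit. Unset Printing Implicit Defensive.
Import Order.TTheory GRing.Theory Num.Theory.
Local Open Scope ring_scope.

(** A maximal Cohen-Macaulay module is y-torsion free, hence is a
    finite-dimensional space V with a decreasing filtration by the degrees n and
    an operator t = xy with t^2 = 0 mapping level n into level n + 1. Such a
    filtered complex splits into bars: the finite arc (a, b) is a pair (e, t e)
    with e in level a and t e in level b, and (-oo, b) is a single vector of
    level b killed by t. Computing extensions on lifted bar generators, a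
    non-split extension exists only for crossing arcs, where the middle term can
    be chosen decomposable, or between two infinite arcs, where it is
    indecomposable. So almost compatible means non-crossing, and since bars have
    local endomorphism rings, adding a module to a subcategory adds exactly the
    arcs of its indecomposable summands. *)

(** The components of a module live in different types [gV M n], and degrees such as n + 1 + k and m
    often agree only propositionally. Placing all components in one vector space removes this
    obstacle: elements of different degrees become comparable, and a homomorphism can be given as a
    single linear map respecting t and the filtration. The components are arbitrary vector spaces
    without chosen bases, so ranks and functionals come from finite spanning lists.

    The list of indecomposables is not assumed: since a bar splits off from every nonzero object, an
    indecomposable object is itself a bar.

    As [almost_compatible] quantifies over all extensions, its two directions differ in nature. For
    a crossing, one non-split conflation with decomposable middle term refutes both clauses at once.
    Without a crossing every conflation has to be analysed; the outcome, split or with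
    indecomposable middle term, yields the second clause, vacuously if everything splits. *)

Notation CC2 := (CC^o * CC^o)%type.

(** * Linear maps given by a bare predicate *)

Section Lin.
Variables (U W : lmodType CC) (f : U -> W).
Hypothesis Lf : lin f.

Lemma linD u v : f (u + v) = f u + f v.
Proof. by rewrite -[u]scale1r Lf !scale1r. Qed.
Lemma lin0 : f 0 = 0.
Proof. by apply: (addrI (f 0)); rewrite -linD !addr0. Qed.
Lemma linZ a u : f (a *: u) = a *: f u.
Proof. by rewrite -[a *: u]addr0 Lf lin0 addr0. Qed.
Lemma linN u : f (- u) = - f u.
Proof. by rewrite -scaleN1r linZ scaleN1r. Qed.
Lemma linB u v : f (u - v) = f u - f v.
Proof. by rewrite linD linN. Qed.
Lemma lin_sum n (a : 'I_n -> CC) (v : 'I_n -> U) :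
  f (\sum_i a i *: v i) = \sum_i a i *: f (v i).
Proof.
elim: n a v => [|n IH] a v; first by rewrite !big_ord0 lin0.
by rewrite !big_ord_recl linD linZ IH.
Qed.
End Lin.

(* [rep t i] exhibits M inside one vector space V, the colimit of the M_n along y: y becomes an inclusion, x becomes t = xy. *)
Definition rep (M : GrData) (V : lmodType CC) (t : V -> V)
    (i : forall n, gV M n -> V) : Prop :=
  [/\ forall n, lin (i n), forall n, injective (i n),
      forall n v, i n (gy v) = i (n + 1) v
    & forall n v, i (n + 1) (gx v) = t (i n v)].

Lemma rep_down M (V : lmodType CC) (t : V -> V) i : @rep M V t i -> forall n m (v : gV M m), n <= m ->
  exists u : gV M n, i n u = i m v.
Proof.
move=> [_ _ iy _] n m v nm.
have [k Ek] : exists k : nat, m = n + k%:Z by exists `|m - n|%N; lia.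
elim: k m v {nm} Ek => [|k IH] m v Ek.
  have E : m = n by lia.
  by move: v; rewrite E => v; exists v.
have E : m = (n + k%:Z) + 1 by lia.
(* [gy] applies only to a degree that is literally a successor, so the type of v is rewritten
   first. *)
move: v; rewrite E => v.
have [u Hu] := IH _ (gy v) erefl.
by exists u; rewrite Hu iy.
Qed.

(** Because f commutes with y, its value in the ambient space depends only on the ambient vector and
    not on the degree in which this vector is represented: f induces one map between the
    colimits. *)
Lemma hom_single_valued M N (V W : lmodType CC) (t : V -> V) (s : W -> W) i k (f : forall n, gV M n -> gV N n) :
  @rep M V t i -> @rep N W s k -> is_hom f ->
  forall n m (u : gV M n) (v : gV M m), i n u = i m v -> k n (f n u) = k m (f m v).
Proof.
move=> [_ iI iy _] [_ _ ky _] [_ _ fy].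
have H : forall (l : nat) n m (u : gV M n) (v : gV M m), m = n + l%:Z ->
    i n u = i m v -> k n (f n u) = k m (f m v).
  elim=> [|l IH] n m u v Ek.
    have E : m = n by lia.
    by move: v; rewrite E => v /iI ->.
  have E : m = (n + l%:Z) + 1 by lia.
  move: v; rewrite E => v; rewrite -iy => /IH -> //.
  by rewrite fy ky.
move=> n m u v E.
have [nm|mn] := leP n m.
  by apply: (H `|m - n|%N) => //; lia.
by apply/esym/(H `|n - m|%N) => //; lia.
Qed.

(** The converse passage, and the source of most homomorphisms below. Commutation with t is required
    only on the images of [i]: for an infinite arc these do not fill [CC2], and the maps used there
    may fail to commute elsewhere. *)
Lemma rep_hom M N (V W : lmodType CC) (t : V -> V) (s : W -> W) i k (phi : V -> W) :
  @rep M V t i -> @rep N W s k -> lin phi ->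
  (forall n v, phi (t (i n v)) = s (phi (i n v))) ->
  (forall n v, exists w, k n w = phi (i n v)) ->
  exists f : forall n, gV M n -> gV N n,
    is_hom f /\ forall n v, k n (f n v) = phi (i n v).
Proof.
move=> [iL iI iy ix] [kL kI ky kx] pL pt pF.
pose f n v := proj1_sig (constructive_indefinite_description _ (pF n v)).
have fE n v : k n (f n v) = phi (i n v).
  by rewrite /f; case: constructive_indefinite_description.
exists f; split=> //; split.
- by move=> n a u v; apply: kI; rewrite fE kL !fE iL pL.
- by move=> n v; apply: kI; rewrite fE kx fE ix pt.
- by move=> n v; apply: kI; rewrite fE ky fE iy.
Qed.

(** * Homomorphisms, summands and direct sums *)

Definition hcomp M N P (g : forall n, gV N n -> gV P n)
  (f : forall n, gV M n -> gV N n) : forall n, gV M n -> gV P n := fun n v => g n (f n v).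

Lemma hom_comp M N P g f : @is_hom N P g -> @is_hom M N f -> is_hom (hcomp g f).
Proof.
move=> [gL gX gY] [fL fX fY]; split; rewrite /hcomp.
- by move=> n a u v; rewrite fL gL.
- by move=> n v; rewrite fX gX.
- by move=> n v; rewrite fY gY.
Qed.

Lemma hom_id M : is_hom (fun n (v : gV M n) => v).
Proof. by split. Qed.

Lemma iso_refl M : iso M M.
Proof. by exists (fun n v => v), (fun n v => v); split=> //; apply: hom_id. Qed.

Lemma iso_sym M N : iso M N -> iso N M.
Proof. by move=> [f [g [hf hg a b]]]; exists g, f. Qed.

Lemma iso_trans M N P : iso M N -> iso N P -> iso M P.
Proof.
move=> [f [g [hf hg a b]]] [f' [g' [hf' hg' a' b']]].
exists (hcomp f' f), (hcomp g g'); split; try exact: hom_comp.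
  by move=> n v; rewrite /hcomp a' a.
by move=> n v; rewrite /hcomp b b'.
Qed.

(** A retract, so that no complement has to be carried along; [summand_split] recovers one as the
    kernel of the projection. *)
Definition summand (Z X : GrData) : Prop :=
  exists (i : forall n, gV Z n -> gV X n) (p : forall n, gV X n -> gV Z n),
    [/\ is_hom i, is_hom p & forall n v, p n (i n v) = v].

Lemma summand_trans X Y Z : summand X Y -> summand Y Z -> summand X Z.
Proof.
move=> [i [p [hi hp a]]] [i' [p' [hi' hp' a']]].
exists (hcomp i' i), (hcomp p p'); split; try exact: hom_comp.
by move=> n v; rewrite /hcomp a' a.
Qed.

Lemma summand_iso M N : iso M N -> summand M N.
Proof. by move=> [f [g [hf hg a b]]]; exists f, g. Qed.

Definition hinl (X Y : GrData) n (v : gV X n) : gV (dsum X Y) n := (v, 0).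
Definition hinr (X Y : GrData) n (v : gV Y n) : gV (dsum X Y) n := (0, v).
Definition hfst (X Y : GrData) n (v : gV (dsum X Y) n) : gV X n := v.1.
Definition hsnd (X Y : GrData) n (v : gV (dsum X Y) n) : gV Y n := v.2.

Lemma pair_eq (U W : Type) (x y : U * W) : x.1 = y.1 -> x.2 = y.2 -> x = y.
Proof. by case: x y => [a b] [c d] /= -> ->. Qed.

Lemma hom_inl X Y : is_grmod Y -> is_hom (@hinl X Y).
Proof.
move=> [yx yy _ _]; split=> [n a u v|n v|n v]; rewrite /hinl /=.
- by apply: pair_eq; rewrite /= ?scaler0 ?addr0.
- by rewrite (lin0 (yx n)).
- by rewrite (lin0 (yy n)).
Qed.
Lemma hom_inr X Y : is_grmod X -> is_hom (@hinr X Y).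
Proof.
move=> [yx yy _ _]; split=> [n a u v|n v|n v]; rewrite /hinr /=.
- by apply: pair_eq; rewrite /= ?scaler0 ?addr0.
- by rewrite (lin0 (yx n)).
- by rewrite (lin0 (yy n)).
Qed.
Lemma hom_fst X Y : is_hom (@hfst X Y).
Proof. by split. Qed.
Lemma hom_snd X Y : is_hom (@hsnd X Y).
Proof. by split. Qed.

Lemma summand_l X Y : is_grmod Y -> summand X (dsum X Y).
Proof.
by move=> gY; exists (@hinl X Y), (@hfst X Y); split; [exact: hom_inl|exact: hom_fst|by []].
Qed.
Lemma summand_r X Y : is_grmod X -> summand Y (dsum X Y).
Proof.
by move=> gX; exists (@hinr X Y), (@hsnd X Y); split; [exact: hom_inr|exact: hom_snd|by []].
Qed.

Lemma dsum_grmod X Y : is_grmod X -> is_grmod Y -> is_grmod (dsum X Y).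
Proof.
move=> [ax ay axx axy] [bx by_ bxx bxy]; split.
- by move=> n a u v /=; rewrite ax bx.
- by move=> n a u v /=; rewrite ay by_.
- by move=> n v /=; rewrite axx bxx.
- by move=> n v /=; rewrite axy bxy.
Qed.

Lemma dsum_MCM X Y : is_MCM X -> is_MCM Y -> is_MCM (dsum X Y).
Proof.
move=> mX mY n [u v] /= [a b] [c d]; congr (_, _); first exact: mX.
exact: mY.
Qed.

Lemma dsum_fin_gen X Y : is_grmod X -> is_grmod Y ->
  fin_gen X -> fin_gen Y -> fin_gen (dsum X Y).
Proof.
move=> gX gY [sX HX] [sY HY].
exists (List.app
  (List.map (fun g : {n : int & gV X n} =>
     existT (fun n => gV (dsum X Y) n) (projT1 g) (hinl Y (projT2 g))) sX)
  (List.map (fun g : {n : int & gV Y n} =>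
     existT (fun n => gV (dsum X Y) n) (projT1 g) (hinr X (projT2 g))) sY)).
move=> S [S0 SL Sx Sy] Sg n v.
have SX : forall n (u : gV X n), S n (hinl Y u).
  apply: HX.
    have [lX xX yX] := hom_inl X gY.
    split=> [m|m a u w Su Sw|m u Su|m u Su].
    - exact: S0.
    - by rewrite lX; exact: SL.
    - by rewrite xX; exact: Sx.
    - by rewrite yX; exact: Sy.
  move=> g Hg; pose g' := existT (fun n => gV (dsum X Y) n) (projT1 g) (hinl Y (projT2 g)).
  apply: (Sg g'); apply/List.in_or_app; left.
  by apply/List.in_map_iff; exists g.
have SY : forall n (u : gV Y n), S n (hinr X u).
  apply: HY.
    have [lX xX yX] := hom_inr Y gX.
    split=> [m|m a u w Su Sw|m u Su|m u Su].
    - exact: S0.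
    - by rewrite lX; exact: SL.
    - by rewrite xX; exact: Sx.
    - by rewrite yX; exact: Sy.
  move=> g Hg; pose g' := existT (fun n => gV (dsum X Y) n) (projT1 g) (hinr X (projT2 g)).
  apply: (Sg g'); apply/List.in_or_app; right.
  by apply/List.in_map_iff; exists g.
have -> : v = 1 *: hinl Y v.1 + hinr X v.2.
  by rewrite scale1r; apply: pair_eq; rewrite /= ?addr0 ?add0r.
exact: SL.
Qed.

Lemma dsum_C2 X Y : C2obj X -> C2obj Y -> C2obj (dsum X Y).
Proof.
move=> [a b c] [a' b' c']; split; [exact: dsum_grmod|exact: dsum_fin_gen|exact: dsum_MCM].
Qed.

Lemma fin_gen_surj M N (f : forall n, gV M n -> gV N n) :
  is_hom f -> (forall n w, exists v, f n v = w) -> fin_gen M -> fin_gen N.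
Proof.
move=> [fL fX fY] fs [s Hs].
exists (List.map (fun g : {n : int & gV M n} =>
     existT (fun n => gV N n) (projT1 g) (f _ (projT2 g))) s).
move=> S [S0 SL Sx Sy] Sg n w; have [v <-] := fs n w.
apply: (Hs (fun n v => S n (f n v))).
  split=> [m|m a u u' Su Su'|m u Su|m u Su].
  - by rewrite (lin0 (fL m)).
  - by rewrite fL; exact: SL.
  - by rewrite fX; exact: Sx.
  - by rewrite fY; exact: Sy.
move=> g Hg; pose g' := existT (fun n => gV N n) (projT1 g) (f _ (projT2 g)).
by apply: (Sg g'); apply/List.in_map_iff; exists g.
Qed.

(** * Complements of summands *)

Section Ker.
Variables (U W : lmodType CC) (f : U -> W) (Lf : lin f).
(** The linearity proof is an argument so that the instance of submodule closure can depend on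
    it. *)
Definition kerp of lin f := [pred u : U | f u == 0].
Fact kerp_submod : submod_closed (kerp Lf).
Proof.
split=> [|a u v]; rewrite !inE ?(lin0 Lf) //.
by rewrite Lf => /eqP-> /eqP->; rewrite scaler0 addr0.
Qed.
HB.instance Definition _ := GRing.isSubmodClosed.Build CC U (kerp Lf) kerp_submod.
Record kerT := KerT { kerv : U; _ : kerv \in kerp Lf }.
HB.instance Definition _ := [isSub for kerv].
HB.instance Definition _ := [Choice of kerT by <:].
HB.instance Definition _ := [SubChoice_isSubLmodule of kerT by <:].
End Ker.

Section KerMod.
Variables (X Z : GrData) (p : forall n, gV X n -> gV Z n).
Hypotheses (gX : is_grmod X) (gZ : is_grmod Z) (hp : is_hom p).

Let pL n : lin (@p n). Proof. by case: hp. Qed.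
Arguments pL : clear implicits.

Lemma ker_gx n (v : kerT (pL n)) : gx (kerv v) \in kerp (pL (n + 1)).
Proof.
case: v => v /=; rewrite !inE => /eqP pv; case: hp => _ px _.
by case: gZ => zx _ _ _; rewrite px pv (lin0 (zx n)).
Qed.
Lemma ker_gy n (v : kerT (pL (n + 1))) : gy (kerv v) \in kerp (pL n).
Proof.
case: v => v /=; rewrite !inE => /eqP pv; case: hp => _ _ py.
by case: gZ => _ zy _ _; rewrite py pv (lin0 (zy n)).
Qed.

Definition kerMod : GrData :=
  @GrDatum (fun n => (kerT (pL n) : lmodType CC))
    (fun n v => KerT (ker_gx v)) (fun n v => KerT (ker_gy v)).

Definition kinc n (v : gV kerMod n) : gV X n := kerv v.

Lemma kinc_inj n : injective (@kinc n).
Proof. exact: val_inj. Qed.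

Lemma kinc_hom : is_hom kinc.
Proof. by split. Qed.

Lemma kinc_ker n v : p (@kinc n v) = 0.
Proof. by case: v => v /=; rewrite inE => /eqP. Qed.

Lemma kinc_surj n v : p v = 0 -> exists w, @kinc n w = v.
Proof.
move=> pv; have H : v \in kerp (pL n) by rewrite inE pv.
by exists (KerT H).
Qed.

Lemma kerMod_grmod : is_grmod kerMod.
Proof.
case: gX => xx xy xxx xxy; split.
- by move=> n a u v; apply: (@kinc_inj (n + 1)); rewrite /kinc /= xx.
- by move=> n a u v; apply: (@kinc_inj n); rewrite /kinc /= xy.
- by move=> n v; apply: (@kinc_inj (n + 1 + 1)); rewrite /kinc /= xxx.
- by move=> n v; apply: (@kinc_inj (n + 1)); rewrite /kinc /= xxy.
Qed.
End KerMod.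

(** The complement is K = ker p, with projection q = id - i p. It is finitely generated as the image
    of X under q, and MCM as a submodule of X. *)
Lemma summand_split Z X : is_grmod Z -> C2obj X -> summand Z X ->
  exists K, C2obj K /\ iso X (dsum Z K).
Proof.
move=> gZ [gX fX mX] [i [p [hi hp pi_id]]].
pose K := kerMod gZ hp.
have pL n : lin (@p n) by have [] := hp.
have iL n : lin (@i n) by case: hi.
have qP n (v : gV X n) : exists w : gV K n, kinc w = v - i n (p n v).
  by apply: kinc_surj; rewrite (linB (pL n)) pi_id subrr.
pose q n v := proj1_sig (constructive_indefinite_description _ (qP n v)).
have qE n v : kinc (q n v) = v - i n (p n v).
  by rewrite /q; case: constructive_indefinite_description.
have [kL kx ky] := kinc_hom gZ hp.
case: (hp) => _ px py; case: (hi) => _ ix iy.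
have [xL yL _ _] := gX.
have hq : is_hom q.
  split.
  - move=> n a u v; apply: (@kinc_inj _ _ _ gZ hp); rewrite kL !qE pL iL.
    by rewrite opprD addrACA scalerBr.
  - by move=> n v; apply: (@kinc_inj _ _ _ gZ hp); rewrite kx !qE px ix (linB (xL n)).
  - by move=> n v; apply: (@kinc_inj _ _ _ gZ hp); rewrite ky !qE py iy (linB (yL n)).
have qk n (w : gV K n) : q n (kinc w) = w.
  by apply: (@kinc_inj _ _ _ gZ hp); rewrite qE kinc_ker (lin0 (iL n)) subr0.
have qi n z : q n (i n z) = 0.
  by apply: (@kinc_inj _ _ _ gZ hp); rewrite qE pi_id subrr (lin0 (kL n)).
have qL n : lin (q n) by case: hq.
have gK : is_grmod K by exact: kerMod_grmod.
exists K; split.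
  split=> //.
    by apply: (fin_gen_surj hq) fX => n w; exists (kinc w).
  move=> n v xv yv; apply: (@kinc_inj _ _ _ gZ hp); rewrite (lin0 (kL _)).
  apply: mX.
    by rewrite -kx xv (lin0 (kL _)).
  by rewrite -ky yv (lin0 (kL _)).
exists (fun n v => (p n v, q n v)), (fun n v => i n v.1 + kinc v.2); split.
- case: hq => _ qx qy; split.
  + by move=> n a u v; rewrite pL qL.
  + by move=> n v; rewrite px qx.
  + by move=> n v; rewrite py qy.
- split.
  + move=> n a u v; rewrite [i n _]iL [X in _ + X = _](kL n a u.2 v.2).
    by rewrite scalerDr addrACA.
  + by move=> n v; rewrite [i _ _]ix [X in _ + X = _](kx n v.2) -(linD (xL n)).
  + by move=> n v; rewrite [i _ _]iy [X in _ + X = _](ky n v.2) -(linD (yL n)).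
- by move=> n v /=; rewrite qE addrC subrK.
- move=> n [a b] /=; rewrite (linD (pL n)) pi_id kinc_ker addr0.
  by rewrite (linD (qL n)) qi qk add0r.
Qed.

(** * Finite-dimensional linear algebra without bases *)

Fixpoint spanned (U : lmodType CC) (gs : seq U) (v : U) : Prop :=
  if gs is g :: gs' then exists a : CC, spanned gs' (v - a *: g) else v = 0.

Lemma spanned_lin (U : lmodType CC) (gs : seq U) (a : CC) u v :
  spanned gs u -> spanned gs v -> spanned gs (a *: u + v).
Proof.
elim: gs u v => [|g gs IH] u v /=; first by move=> -> ->; rewrite scaler0 addr0.
move=> [b Hb] [c Hc]; exists (a * b + c).
have -> : a *: u + v - (a * b + c) *: g = a *: (u - b *: g) + (v - c *: g).
  by rewrite scalerBr scalerA scalerDl opprD addrACA.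
exact: IH.
Qed.

Lemma spanned0 (U : lmodType CC) (gs : seq U) : spanned gs 0.
Proof. by elim: gs => //= g gs IH; exists 0; rewrite scale0r subr0. Qed.

Lemma spanned_mem (U : lmodType CC) (gs : seq U) g : List.In g gs -> spanned gs g.
Proof.
elim: gs => //= h gs IH [->|/IH H].
  by exists 1; rewrite scale1r subrr; exact: spanned0.
by exists 0; rewrite scale0r subr0.
Qed.

Lemma spannedP (U : lmodType CC) (gs : seq U) v : spanned gs v ->
  exists a : 'I_(size gs) -> CC, v = \sum_i a i *: nth 0 gs i.
Proof.
elim: gs v => [|g gs IH] v /=; first by move=> ->; exists (fun=> 0); rewrite big_ord0.
move=> [b /IH[a Ha]].
exists (fun i => if unlift ord0 i is Some j then a j else b).
rewrite big_ord_recl unlift_none /=.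
under eq_bigr => i _ do rewrite liftK /=.
by rewrite -Ha addrC subrK.
Qed.

Definition dependent (U : lmodType CC) d (v : 'I_d -> U) : Prop :=
  exists a : 'I_d -> CC, (exists i, a i != 0) /\ \sum_i a i *: v i = 0.

(** Expressing the vectors by fewer generators gives a coefficient matrix with more rows than
    columns; a nonzero vector of its left kernel is the relation. *)
Lemma spanned_dependent (U : lmodType CC) (gs : seq U) d (v : 'I_d -> U) :
  (size gs < d)%N -> (forall i, spanned gs (v i)) -> dependent v.
Proof.
move=> lt_d H.
have H' i := spannedP (H i).
pose A := \matrix_(i, j) proj1_sig (constructive_indefinite_description _ (H' i)) j.
have EA i : v i = \sum_j A i j *: nth 0 gs j.
  under eq_bigr => j _ do rewrite mxE.
  by case: constructive_indefinite_description.
have : kermx A != 0.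
  by rewrite kermx_eq0 /row_free neq_ltn (leq_ltn_trans (rank_leq_col A)).
case/rowV0Pn=> b /sub_kermxP bA /rV0Pn[i bi].
exists (fun i => b 0 i); split; first by exists i.
under eq_bigr => k _ do rewrite EA scaler_sumr.
rewrite exchange_big /= big1 // => j _.
under eq_bigr => k _ do rewrite scalerA.
rewrite -scaler_suml.
have -> : \sum_k b 0 k * A k j = (b *m A) 0 j by rewrite mxE.
by rewrite bA mxE scale0r.
Qed.

(* A subspace maximal among those containing S and avoiding w is a hyperplane complementing w; the functional is the w-coordinate. *)
Lemma functional_extension (U : lmodType CC) (gs : seq U) (S : U -> Prop) (w : U) :
  (forall v, spanned gs v) -> S 0 ->
  (forall (a : CC) u v, S u -> S v -> S (a *: u + v)) -> ~ S w ->
  exists psi : U -> CC^o, [/\ lin psi, forall v, S v -> psi v = 0 & psi w = 1].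
Proof.
move=> gsT S0 SL Sw.
have [T [T0 TL Tw ST Tg]] : exists T : U -> Prop,
    [/\ T 0, forall (a : CC) u v, T u -> T v -> T (a *: u + v), ~ T w,
        forall v, S v -> T v
      & forall g, List.In g gs -> exists a : CC, T (g - a *: w)].
  (* Each generator g is added to T unless it is already a multiple of w modulo T. Adding it never
     brings in w: a relation w - a g in T with a nonzero would make g such a multiple. *)
  elim: (gs) => [|g l [T [T0 TL Tw ST Tg]]]; first by exists S.
  have [H|H] := classic (exists a : CC, T (g - a *: w)).
    exists T; split=> // h [<-|] //; exact: Tg.
  exists (fun u => exists a : CC, T (u - a *: g)); split.
  - by exists 0; rewrite scale0r subr0.
  - move=> a u v [b Tu] [c Tv]; exists (a * b + c).
    have -> : a *: u + v - (a * b + c) *: g = a *: (u - b *: g) + (v - c *: g).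
      by rewrite scalerBr scalerA scalerDl opprD addrACA.
    exact: TL.
  - move=> [a Ta]; have [a0|a0] := eqVneq a 0.
      by apply: Tw; move: Ta; rewrite a0 scale0r subr0.
    apply: H; exists a^-1.
    have := TL (- a^-1) _ _ Ta T0.
    rewrite addr0 scalerBr !scalerA mulNr mulVf // scaleNr scaleN1r opprK.
    by rewrite addrC.
  - by move=> v /ST Tv; exists 0; rewrite scale0r subr0.
  - move=> h [<-|/Tg[a Ta]].
      by exists 0; exists 1; rewrite scale0r subr0 scale1r subrr.
    by exists a; exists 0; rewrite scale0r subr0.
have TA v : exists a : CC, T (v - a *: w).
  have := gsT v; elim: (gs) Tg v => [|g l IH] Tg v /=.
    by move=> ->; exists 0; rewrite scale0r subr0.
  move=> [b /IH[]]; first by move=> h Hh; apply: Tg; right.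
  move=> a Ta; have [c Tc] := Tg g (or_introl erefl).
  exists (b * c + a).
  have -> : v - (b * c + a) *: w = b *: (g - c *: w) + (v - b *: g - a *: w).
    rewrite scalerBr scalerA scalerDl opprD [RHS]addrACA.
    by rewrite (addrCA (b *: g)) subrr addr0.
  exact: TL.
have TU v (a b : CC) : T (v - a *: w) -> T (v - b *: w) -> a = b.
  move=> Ta Tb; apply/eqP/negPn/negP => ab; apply: Tw.
  have := TL (- 1) _ _ Ta Tb.
  rewrite scaleN1r opprB addrA subrK -scalerBl => Tc.
  have := TL (a - b)^-1 _ _ Tc T0.
  by rewrite addr0 scalerA mulVf ?subr_eq0 // scale1r.
pose psi v : CC^o := proj1_sig (constructive_indefinite_description _ (TA v)).
have psiE v : T (v - psi v *: w).
  by rewrite /psi; case: constructive_indefinite_description.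
exists psi; split.
- move=> a u v; apply: TU (psiE _) _.
  have -> : a *: u + v - (a *: psi u + psi v) *: w
    = a *: (u - psi u *: w) + (v - psi v *: w).
    by rewrite scalerBr scalerA scalerDl opprD addrACA.
  exact: TL.
- by move=> v /ST Tv; apply: TU (psiE _) _; rewrite scale0r subr0.
- by apply: TU (psiE _) _; rewrite scale1r subrr.
Qed.

(** * The ambient vector space of a graded module *)

(** If y w = 0, then x w is killed by x and by y, so x w = 0 by the MCM property; a second
    application gives w = 0. *)
Lemma gy_inj M : C2obj M -> forall n, injective (@gy M n).
Proof.
move=> [[xL yL xx xy] _ mcm] n u v E; apply/eqP; rewrite -subr_eq0; apply/eqP.
have yw : gy (u - v) = 0 by rewrite (linB (yL n)) E subrr.
apply: (mcm _ _) => //; apply: (mcm _ _); first exact: xx.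
by rewrite xy yw (lin0 (xL n)).
Qed.

(** If D bounds the degrees of the generators, only x can lead above D, and only once since x^2 = 0.
    Hence everything vanishes from degree D + 2 on. *)
Lemma bounded_above M : is_grmod M -> fin_gen M ->
  exists B : int, forall n (v : gV M n), B <= n -> v = 0.
Proof.
move=> [xL yL xx xy] [gs Hg].
have [D HD] : exists D : int, forall g, List.In g gs -> projT1 g <= D.
  elim: (gs) => [|g l [D HD]]; first by exists 0.
  exists (Num.max D (projT1 g)) => h /= [<-|/HD]; lia.
exists (D + 2) => n v Dn.
have : (n <= D) \/ (v = 0) \/ ((n <= D + 1) /\ gx v = 0).
  apply: (Hg (fun n (v : gV M n) => (n <= D) \/ (v = 0) \/ ((n <= D + 1) /\ gx v = 0))).
    split.
    - by move=> m; right; left.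
    - move=> m a u w [mD|Hu] [mD'|Hw]; try by left.
      right; case: Hu => [->|[mD xu]]; case: Hw => [->|[mD' xw]].
      + by left; rewrite scaler0 addr0.
      + by right; split=> //; rewrite scaler0 add0r.
      + by right; split=> //; rewrite addr0 (linZ (xL m)) xu scaler0.
      + by right; split=> //; rewrite xL xu xw scaler0 addr0.
    - move=> m u [mD|[->|[mD ->]]].
      + by right; right; rewrite xx; split=> //; lia.
      + by right; left; rewrite (lin0 (xL m)).
      + by right; left.
    - move=> m u [mD|[->|[mD _]]].
      + by left; lia.
      + by right; left; rewrite (lin0 (yL m)).
      + by left; lia.
  by move=> g /HD; left.
by case=> [|[//|[]]]; lia.
Qed.

(** Below the degrees of all generators an element can only arise through y; a multiple by x of such
    an element is again divisible by y because x y = y x. *)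
Lemma gy_surj_below M : is_grmod M -> fin_gen M ->
  exists N : int, forall n (v : gV M n), n < N -> exists u, gy u = v.
Proof.
move=> [xL yL xx xy] [gs Hg].
have [D HD] : exists D : int, forall g, List.In g gs -> D <= projT1 g.
  elim: (gs) => [|g l [D HD]]; first by exists 0.
  exists (Num.min D (projT1 g)) => h /= [<-|/HD]; lia.
exists D; apply: (Hg (fun n (v : gV M n) => n < D -> exists u, gy u = v)).
  split.
  - by move=> n _; exists 0; rewrite (lin0 (yL n)).
  - move=> n a u v Hu Hv nD; have [u' <-] := Hu nD; have [v' <-] := Hv nD.
    by exists (a *: u' + v'); rewrite yL.
  - move=> n u Hu nD; have [|u' <-] := Hu; first by lia.
    by exists (gx u'); rewrite xy.
  - by move=> n u _ _; exists u.
by move=> g /HD gD gD'; lia.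
Qed.

Section Pushdown.
Variable M : GrData.

Definition gcast n m (e : n = m) (v : gV M n) : gV M m := eq_rect n (gV M) v m e.

Fact ypow_proof0 (n m : int) : n + 0%:Z = m -> m = n. Proof. by move=> <-; rewrite addr0. Qed.
Fact ypow_proofS (n m : int) k : n + k.+1%:Z = m -> n + 1 + k%:Z = m.
Proof. by move=> <-; lia. Qed.

(** The k-th power of y. The equation between degrees is an argument, so source and target can be
    named freely; proofs of it are interchangeable because [int] has decidable equality. *)
Fixpoint ypow (k : nat) (n m : int) : n + k%:Z = m -> gV M m -> gV M n :=
  match k with
  | 0 => fun e v => gcast (ypow_proof0 e) v
  | k'.+1 => fun e v => gy (ypow (ypow_proofS e) v)
  end.

Lemma ypow0 n e v : @ypow 0 n n e v = v.
Proof. by rewrite /= (eq_irrelevance (ypow_proof0 e) erefl). Qed.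

Lemma ypow_gy k n m e e' (v : gV M (m + 1)) : @ypow k n m e (gy v) = @ypow k.+1 n (m + 1) e' v.
Proof.
elim: k n e e' => [|k IH] n e e'.
  have E : m = n by rewrite -e addr0.
  move: v e e'; rewrite E => v e e'; rewrite ypow0 /=.
  by rewrite (eq_irrelevance (ypow_proof0 _) erefl).
rewrite [RHS]/= -[LHS]/(gy (ypow (ypow_proofS e) (gy v))).
by rewrite (IH _ _ (ypow_proofS e')).
Qed.

Lemma ypow_comp c a p' p n e1 e2 e3 (v : gV M n) :
  @ypow c p' p e1 (@ypow a p n e2 v) = @ypow (c + a) p' n e3 v.
Proof.
elim: c p' e1 e3 => [|c IH] p' e1 e3.
  have E : p = p' by rewrite -e1 addr0.
  move: e1 e2 e3; rewrite E => e1 e2 e3; rewrite ypow0.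
  by congr ypow; exact: eq_irrelevance.
rewrite /= (IH _ _ (ypow_proofS e3)); congr gy.
Qed.

Hypothesis gM : is_grmod M.

Lemma ypow_lin k n m e : lin (@ypow k n m e).
Proof.
elim: k n m e => [|k IH] n m e a u v.
  have E : m = n by rewrite -e addr0.
  by move: u v e; rewrite E => u v e; rewrite !ypow0.
by rewrite /= IH; case: gM => _ yL _ _; rewrite yL.
Qed.

Lemma ypow_gx k n m e e' v : gx (@ypow k n m e v) = @ypow k (n + 1) (m + 1) e' (gx v).
Proof.
elim: k n e e' => [|k IH] n e e'.
  have E : m = n by rewrite -e addr0.
  by move: v e e'; rewrite E => v e e'; rewrite !ypow0.
by case: (gM) => _ _ _ xy; rewrite /= -xy (IH _ _ (ypow_proofS e')).
Qed.

Lemma ypow_inj k n m e : C2obj M -> injective (@ypow k n m e).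
Proof.
move=> cM; elim: k n m e => [|k IH] n m e u v.
  have E : m = n by rewrite -e addr0.
  by move: u v e; rewrite E => u v e; rewrite !ypow0.
by move=> /= /(gy_inj cM) /IH.
Qed.
End Pushdown.

(* Below the degrees of the generators y is bijective, so one component M_N with N small serves as the colimit. *)
Lemma exists_rep M : C2obj M ->
  exists (V : lmodType CC) (t : V -> V) (i : forall n, gV M n -> V) (gs : seq V),
    [/\ rep t i, lin t, exists N, forall w, exists v, i N v = w
      & forall v, spanned gs v].
Proof.
move=> cM; have [gM fM mM] := cM; have [xL yL xx xy] := gM.
have [N HN] := gy_surj_below gM fM.
(* K is the graph of the embedding of M_n into M_N: v and w become equal when pushed down by y to a
   common degree p, and then in every degree below p. *)
pose K n v w := exists p a b e1 e2, @ypow M a p n e1 v = @ypow M b p N e2 w.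
have Kdown n v w : K n v w -> exists p0, forall p, p <= p0 ->
    forall a b e1 e2, @ypow M a p n e1 v = @ypow M b p N e2 w.
  move=> [p0 [a0 [b0 [e1 [e2 E]]]]]; exists p0 => p pp0 a b e3 e4.
  have [c Ec] : exists c : nat, p + c%:Z = p0 by exists `|p0 - p|%N; lia.
  have Ea : a = (c + a0)%N by lia.
  have Eb : b = (c + b0)%N by lia.
  move: e3 e4; rewrite Ea Eb => e3 e4.
  by rewrite -(ypow_comp Ec e1) -(ypow_comp Ec e2) E.
have pick (l : seq int) : exists p : int, forall q, q \in l -> p <= q.
  elim: l => [|q l [p Hp]]; first by exists 0.
  by exists (Num.min p q) => r; rewrite inE => /orP[/eqP->|/Hp]; lia.
have shift (p n : int) : p <= n -> exists a : nat, p + a%:Z = n.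
  by move=> pn; exists `|n - p|%N; lia.
have Klin n (a : CC) u v w w' : K n u w -> K n v w' -> K n (a *: u + v) (a *: w + w').
  move=> /Kdown[p1 H1] /Kdown[p2 H2]; have [p Hp] := pick [:: p1; p2; n; N].
  have [|c e1] := shift p n; first by apply: Hp; rewrite !inE eqxx !orbT.
  have [|d e2] := shift p N; first by apply: Hp; rewrite !inE eqxx !orbT.
  exists p, c, d, e1, e2; rewrite !ypow_lin // (H1 p _ _ d e1 e2) ?(H2 p _ _ d e1 e2) //.
    by apply: Hp; rewrite !inE eqxx !orbT.
  by apply: Hp; rewrite !inE eqxx.
have Kfun n v w w' : K n v w -> K n v w' -> w = w'.
  move=> /Kdown[p1 H1] /Kdown[p2 H2]; have [p Hp] := pick [:: p1; p2; n; N].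
  have [|c e1] := shift p n; first by apply: Hp; rewrite !inE eqxx !orbT.
  have [|d e2] := shift p N; first by apply: Hp; rewrite !inE eqxx !orbT.
  apply: (@ypow_inj _ d p N e2 cM).
  rewrite -(H1 p _ c d e1 e2) ?(H2 p _ c d e1 e2) //.
    by apply: Hp; rewrite !inE eqxx !orbT.
  by apply: Hp; rewrite !inE eqxx.
have Kinj n v v' w : K n v w -> K n v' w -> v = v'.
  move=> /Kdown[p1 H1] /Kdown[p2 H2]; have [p Hp] := pick [:: p1; p2; n; N].
  have [|c e1] := shift p n; first by apply: Hp; rewrite !inE eqxx !orbT.
  have [|d e2] := shift p N; first by apply: Hp; rewrite !inE eqxx !orbT.
  apply: (@ypow_inj _ c p n e1 cM).
  rewrite (H1 p _ c d e1 e2) ?(H2 p _ c d e1 e2) //.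
    by apply: Hp; rewrite !inE eqxx !orbT.
  by apply: Hp; rewrite !inE eqxx.
have Ktot n v : exists w, K n v w.
  have [Nn|nN] := leP N n.
    have [a e1] := shift N n Nn.
    have e2 : N + 0%:Z = N by rewrite addr0.
    by exists (ypow e1 v), N, a, 0%N, e1, e2; rewrite ypow0.
  have [|b e2] := shift n N; first by lia.
  (* For n < N the element v is pulled up to degree N, one surjective step of y at a time. *)
  have [w Hw] : exists w, ypow e2 w = v.
    elim: b n e2 v nN => [|b IH] n e2 v nN; first by lia.
    have [v' Ev] := HN n v nN.
    have e3 := ypow_proofS e2.
    have [w Hw] : exists w, ypow e3 w = v'.
      case: (b) IH e3 => [|b'] IH e3.
        have E : n + 1 = N by lia.
        move: v' e3 {Ev}; rewrite E.
        by move=> v' e3; exists v'; rewrite ypow0.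
      by apply: IH; lia.
    by exists w; rewrite /= (eq_irrelevance (ypow_proofS e2) e3) Hw.
  have e1 : n + 0%:Z = n by rewrite addr0.
  by exists w, n, 0%N, b, e1, e2; rewrite ypow0 Hw.
pose i n v := proj1_sig (constructive_indefinite_description _ (Ktot n v)).
have iK n v : K n v (i n v) by rewrite /i; case: constructive_indefinite_description.
have iN w : i N w = w.
  apply: Kfun (iK _ _) _; have e : N + 0%:Z = N by rewrite addr0.
  by exists N, 0%N, 0%N, e, e; rewrite ypow0.
have R : rep (fun w : gV M N => gy (gx w)) i.
  split.
  - by move=> n a u v; apply: Kfun (iK _ _) _; apply: Klin.
  - by move=> n u v E; apply: Kinj (iK n u) _; rewrite E.
  - move=> n v; apply: Kfun (iK _ _) _.
    have [p [a [b [e1 [e2 E]]]]] := iK _ v.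
    have e1' : p - 1 + a%:Z = n by lia.
    have e2' : p - 1 + 1%N%:Z = p by lia.
    have e3 : p - 1 + a.+1%:Z = n + 1 by lia.
    have e4 : p - 1 + b.+1%:Z = N by lia.
    exists (p - 1), a, b.+1, e1', e4; rewrite (ypow_gy e1' e3).
    have e3' : p - 1 + (1 + a)%N%:Z = n + 1 by lia.
    have e4' : p - 1 + (1 + b)%N%:Z = N by lia.
    have := ypow_comp e2' e1 e3' v; have := ypow_comp e2' e2 e4' (i (n + 1) v).
    rewrite E => ->; rewrite !add1n in e3' e4' *.
    by rewrite (eq_irrelevance e3 e3') (eq_irrelevance e4 e4').
  - move=> n v; apply: Kfun (iK _ _) _.
    have [p [a [b [e1 [e2 E]]]]] := iK _ v.
    have e1' : p + a.+1%:Z = n + 1 by lia.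
    have e1'' : p + 1 + a%:Z = n + 1 by lia.
    have e2'' : p + 1 + b%:Z = N + 1 by lia.
    have e2''' : p + b.+1%:Z = N + 1 by lia.
    exists p, a.+1, b, e1', e2; rewrite (ypow_gy e2 e2''').
    rewrite /= (eq_irrelevance (ypow_proofS e1') e1'') (eq_irrelevance (ypow_proofS e2''') e2'').
    by rewrite -!(ypow_gx gM _ _) E.
have [gs Hg] := fM.
pose ts := fun w : gV M N => gy (gx w).
have tL : lin ts by move=> a u v; rewrite /ts xL yL.
have tt v : ts (ts v) = 0 by rewrite /ts -xy xx !(lin0 (yL _)).
exists (gV M N : lmodType CC), ts, i.
(* In the ambient space y is invisible and t^2 = 0, so the images of the generators together with
   their images under t span it. *)
pose l0 := List.map (fun g : {n : int & gV M n} => i _ (projT2 g)) gs.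
pose l := List.app l0 (List.map ts l0).
exists l; split=> //; first by exists N => w; exists w.
have [iL iI iy ix] := R.
have lt v : spanned l v -> spanned l (ts v).
  have E1 u : List.In u l -> spanned l (ts u).
    move=> /List.in_app_iff[H|/List.in_map_iff[u' [<- _]]].
      by apply/spanned_mem/List.in_app_iff; right; apply: List.in_map.
    by rewrite tt; exact: spanned0.
  move: E1; move: {1 3}l => l1; elim: l1 v => [|g l1 IH] v E1 /=.
    by move=> ->; rewrite (lin0 tL) => *; exact: spanned0.
  move=> [a /IH H].
  have -> : ts v = a *: ts g + ts (v - a *: g).
    by rewrite (linB tL) (linZ tL) addrC subrK.
  apply: spanned_lin; first by apply: E1; left.
  by apply: H => u Hu; apply: E1; right.
move=> w; rewrite -(iN w).
apply: (Hg (fun n v => spanned l (i n v))).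
  split.
  - by move=> n; rewrite (lin0 (iL n)); exact: spanned0.
  - by move=> n a u v Hu Hv; rewrite iL; exact: spanned_lin.
  - by move=> n u /lt; rewrite ix.
  - by move=> n u; rewrite iy.
move=> g /= Hgg; apply/spanned_mem/List.in_app_iff; left.
by apply/List.in_map_iff; exists g.
Qed.

(** * Arcs as bars *)

Definition bar_t (w : CC2) : CC2 := (0, w.1).
Definition le_end (n : int) (o : option int) : bool := if o is Some a then n <= a else false.
Definition in_bar (al : Defs.arc) (n : int) (w : CC2) : bool :=
  ((w.1 == 0) || le_end n al.1) && ((w.2 == 0) || (n <= al.2)).

(* The bar of the arc (a, b) has basis e = (1, 0) living in degrees n <= a and t e = (0, 1) living in degrees n <= b; when a = -oo the vector e is absent. *)
Definition model (al : Defs.arc) (M : GrData) (i : forall n, gV M n -> CC2) : Prop :=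
  rep bar_t i /\ forall n w, (exists v, i n v = w) <-> in_bar al n w.
Definition has_model al M := exists i, @model al M i.

Lemma CC2_eq (x y : CC2) : x.1 = y.1 -> x.2 = y.2 -> x = y.
Proof. by case: x y => [a b] [c d] /= -> ->. Qed.

Lemma bar_t_lin : lin bar_t.
Proof. by move=> a u v; apply: CC2_eq => //=; rewrite scaler0 addr0. Qed.

Lemma bar_t_square w : bar_t (bar_t w) = 0.
Proof. by []. Qed.

Lemma model_hom al be M N i k (phi : CC2 -> CC2) :
  @model al M i -> @model be N k -> lin phi ->
  (forall n v, phi (bar_t (i n v)) = bar_t (phi (i n v))) ->
  (forall n w, in_bar al n w -> in_bar be n (phi w)) ->
  exists f : forall n, gV M n -> gV N n, is_hom f /\ forall n v, k n (f n v) = phi (i n v).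
Proof.
move=> [ri Fi] [rk Fk] pL pt pF; apply: (rep_hom ri rk pL pt) => n v.
by apply/Fk/pF/Fi; exists v.
Qed.

(** The identity of the plane respects both filtrations, which are the same; hence an arc determines
    its module up to isomorphism. *)
Lemma model_iso al M N : has_model al M -> has_model al N -> iso M N.
Proof.
move=> [i mi] [k mk].
have [f [hf fE]] := @model_hom _ _ _ _ _ _ id mi mk (fun _ _ _ => erefl)
  (fun _ _ => erefl) (fun _ _ h => h).
have [g [hg gE]] := @model_hom _ _ _ _ _ _ id mk mi (fun _ _ _ => erefl)
  (fun _ _ => erefl) (fun _ _ h => h).
have [[_ iI _ _] _] := mi; have [[_ kI _ _] _] := mk.
exists f, g; split=> // n v; first by apply: iI; rewrite gE fE.
by apply: kI; rewrite fE gE.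
Qed.

Lemma iso_model al M N : iso M N -> has_model al M -> has_model al N.
Proof.
move=> [f [g [hf hg gf fg]]] [i [[iL iI iy ix] iF]].
have [gL gX gY] := hg.
exists (fun n v => i n (g n v)); split.
  split.
  - by move=> n a u v; rewrite gL iL.
  - by move=> n u v /iI E; rewrite -(fg n u) E fg.
  - by move=> n v; rewrite gY iy.
  - by move=> n v; rewrite gX ix.
move=> n w; rewrite -iF; split=> [[v <-]|[v <-]]; first by exists (g n v).
by exists (f n v); rewrite gf.
Qed.

(** * The standard modules as bars *)

Section Coef.

(** Entry k of v, and 0 when k is out of range. Natural number indices make rows of different
    lengths comparable, as the dimension varies with the degree. *)
Definition coef m (v : 'rV[CC]_m) (k : nat) : CC := \sum_(i < m) v 0 i * (i == k :> nat)%:R.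

Lemma coef_lin m a (u v : 'rV[CC]_m) k : coef (a *: u + v) k = a * coef u k + coef v k.
Proof.
by rewrite /coef mulr_sumr -big_split /=; apply: eq_bigr => i _; rewrite !mxE mulrDl mulrA.
Qed.

Lemma coef_ord m (v : 'rV[CC]_m) (i : 'I_m) : coef v i = v 0 i.
Proof.
rewrite /coef (bigD1 i) //= eqxx mulr1 big1 ?addr0 // => j ji.
by rewrite -val_eqE /= in ji; rewrite (negbTE ji) mulr0.
Qed.

Lemma coef_big m (v : 'rV[CC]_m) k : (m <= k)%N -> coef v k = 0.
Proof.
move=> mk; rewrite /coef big1 // => i _; case: eqP => [E|_]; last by rewrite mulr0.
by have := ltn_ord i; rewrite E ltnNge mk.
Qed.

Lemma coef_pat_id m m' (v : 'rV[CC]_m) k : (k < m')%N -> coef (v *m pat_id m m') k = coef v k.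
Proof.
move=> km; rewrite -[k]/(val (Ordinal km)) coef_ord mxE /coef.
by apply: eq_bigr => i _; rewrite mxE.
Qed.

Lemma coef_pat_x m m' (v : 'rV[CC]_m) k : (k < m')%N ->
  coef (v *m pat_x m m') k = if k == 0%N then coef v 1 else 0.
Proof.
move=> km; rewrite -[k]/(val (Ordinal km)) coef_ord mxE /coef /=.
case: ifP => k0; last by rewrite big1 // => i _; rewrite mxE /= k0 andbF mulr0.
by apply: eq_bigr => i _; rewrite mxE /= k0 andbT.
Qed.
End Coef.

Lemma ideal_model k j : has_model (Some (- j - k%:Z), 1 - j) (IdealMod k j).
Proof.
(* The coordinates are swapped: the second basis vector y^(-j-n) is e, and the first, x y^(1-j-n),
   is t e. *)
exists (fun n v => (coef v 1, coef v 0)).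
have d2 n : (dimI k j n <= 2)%N by rewrite /dimI; do 2!case: (_ <= _)%R.
have dS n : (dimI k j (n + 1) <= dimI k j n)%N by rewrite /dimI; lia.
have d1 n : (0 < dimI k j n)%N = (n <= 1 - j) by rewrite /dimI; lia.
have d0 n : (1 < dimI k j n)%N = (n <= - j - k%:Z) by rewrite /dimI; lia.
(* If e is present in degree n, then t e is present in degree n + 1, so the matrix of x is never
   truncated. *)
have dX n : (1 < dimI k j n)%N -> (0 < dimI k j (n + 1))%N by rewrite d0 d1; lia.
split.
  split.
  - by move=> n a u v; rewrite !coef_lin.
  - move=> n u v [E1 E0]; apply/matrixP => i l; rewrite (ord1 i) -!coef_ord.
    have := leq_trans (ltn_ord l) (d2 n).
    by case: (val l) => [|[|//]] _.
  - move=> n v /=; apply: CC2_eq => /=.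
      have [h|h] := ltnP 1 (dimI k j n); first by rewrite coef_pat_id.
      by rewrite !coef_big // (leq_trans _ h).
    have [h|h] := ltnP 0 (dimI k j n); first by rewrite coef_pat_id.
    by rewrite !coef_big // (leq_trans _ h).
  - move=> n v; apply: CC2_eq => /=.
      have [h|h] := ltnP 1 (dimI k j (n + 1)); first by rewrite coef_pat_x.
      by rewrite coef_big.
    have [h|h] := ltnP 0 (dimI k j (n + 1)); first by rewrite coef_pat_x.
    rewrite coef_big // coef_big // leqNgt; apply/negP => /dX.
    by rewrite ltnNge h.
move=> n w; rewrite /in_bar /= -d0 -d1; split=> [[v <-] /=|].
  have [h|h] := ltnP 1 (dimI k j n); first by rewrite orbT (ltnW h) orbT.
  rewrite (coef_big _ h) eqxx /=.
  have [h'|h'] := ltnP 0 (dimI k j n); first by rewrite orbT.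
  by rewrite coef_big // eqxx.
move=> /andP[w1 w2].
exists (\row_l if val l == 1%N then w.1 else w.2).
apply: CC2_eq => /=.
  have [h|h] := ltnP 1 (dimI k j n).
    by rewrite -[1%N]/(val (Ordinal h)) coef_ord mxE.
  by move: w1; rewrite (ltnNge 1) h orbF => /eqP->; rewrite coef_big.
have [h|h] := ltnP 0 (dimI k j n).
  by rewrite -[0%N]/(val (Ordinal h)) coef_ord mxE.
by move: w2; rewrite (ltnNge 0) h orbF => /eqP->; rewrite coef_big.
Qed.

Lemma cy_model j : has_model (None, - j) (CyMod j).
Proof.
exists (fun n v => (0, coef v 0)).
have d1 n : (0 < dimC j n)%N = (n <= - j) by rewrite /dimC; lia.
have d2 n : (dimC j n <= 1)%N by rewrite /dimC; case: (_ <= _)%R.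
split.
  split.
  - by move=> n a u v; apply: CC2_eq; rewrite /= ?coef_lin // scaler0 addr0.
  - move=> n u v [E0]; apply/matrixP => i l; rewrite (ord1 i) -!coef_ord.
    have := leq_trans (ltn_ord l) (d2 n).
    by case: (val l) => [|//] _.
  - move=> n v /=; apply: CC2_eq => //=.
    have [h|h] := ltnP 0 (dimC j n); first by rewrite coef_pat_id.
    rewrite !coef_big //; apply: leq_trans h; rewrite /dimC; lia.
  - move=> n v; apply: CC2_eq => //=.
    by rewrite /coef big1 // => i _; rewrite mxE mul0r.
move=> n w; rewrite /in_bar /= -d1 orbF; split=> [[v <-] /=|].
  have [h|h] := ltnP 0 (dimC j n); first by rewrite orbT eqxx.
  by rewrite coef_big // eqxx.
move=> /andP[/eqP w1 w2].
exists (\row_l w.2); apply: CC2_eq => //=.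
have [h|h] := ltnP 0 (dimC j n).
  by rewrite -[0%N]/(val (Ordinal h)) coef_ord mxE.
by move: w2; rewrite (ltnNge 0) h orbF => /eqP->; rewrite coef_big.
Qed.

Lemma corresponds_has_model M al : corresponds M al -> has_model al M.
Proof.
case: al => [[a|] b] /=.
  by move=> [k [j [-> [-> H]]]]; apply: iso_model (iso_sym H) (ideal_model k j).
by move=> [j [-> H]]; apply: iso_model (iso_sym H) (cy_model j).
Qed.

Lemma exists_corresponds al : valid_arc al -> exists M, corresponds M al.
Proof.
case: al => [[a|] b] /=; rewrite /valid_arc /= => ab.
  (* Solving a = -j - k and b = 1 - j gives j = 1 - b and k = b - 1 - a, which is nonnegative since
     a < b. *)
  exists (IdealMod (absz (b - 1 - a)%R) (1 - b)), (absz (b - 1 - a)%R), (1 - b).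
  by split; [lia|split; [lia|exact: iso_refl]].
by exists (CyMod (- b)), (- b); rewrite opprK; split=> //; exact: iso_refl.
Qed.

Lemma has_model_corresponds M al : valid_arc al -> has_model al M -> corresponds M al.
Proof.
move=> va mM; have [N cN] := exists_corresponds va.
have /(model_iso mM) MN := corresponds_has_model cN.
case: al cN {va mM} => [[a|] b] /=.
  by move=> [k [j [-> [-> H]]]]; exists k, j; do 2!split=> //; exact: iso_trans MN H.
by move=> [j [-> H]]; exists j; split=> //; exact: iso_trans MN H.
Qed.

Lemma submodule_down M (V : lmodType CC) (t : V -> V) i S :
  @rep M V t i -> @graded_submodule M S ->
  forall n m (v : gV M m), n <= m -> S m v -> exists u, i n u = i m v /\ S n u.
Proof.
move=> [_ _ iy _] [_ _ _ Sy] n m v nm.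
have [k Ek] : exists k : nat, m = n + k%:Z by exists `|m - n|%N; lia.
elim: k m v {nm} Ek => [|k IH] m v Ek Sv.
  have E : m = n by lia.
  by move: v Sv; rewrite E => v Sv; exists v.
have E : m = (n + k%:Z) + 1 by lia.
move: v Sv; rewrite E => v Sv.
have [u Hu] := IH _ (gy v) erefl (Sy _ _ Sv).
by exists u; rewrite -iy.
Qed.

Lemma in_bar10 a b n : in_bar (Some a, b) n (1, 0) = (n <= a).
Proof. by rewrite /in_bar /= oner_eq0 eqxx andbT. Qed.
Lemma in_bar01 a b n : in_bar (a, b) n (0, 1) = (n <= b).
Proof. by rewrite /in_bar /= oner_eq0 eqxx. Qed.

Lemma rep_grmod M (V : lmodType CC) (t : V -> V) i : @rep M V t i -> lin t ->
  (forall n (v : gV M n), t (t (i n v)) = 0) -> is_grmod M.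
Proof.
move=> [iL iI iy ix] tL tt; split.
- by move=> n a u v; apply: iI; rewrite ix iL tL iL !ix.
- by move=> n a u v; apply: iI; rewrite iy !iL !iy.
- by move=> n v; apply: iI; rewrite !ix tt (lin0 (iL _)).
- by move=> n v; apply: iI; rewrite !(iy, ix).
Qed.

(** Generators are t e in its top degree b and, for a finite arc, e in its top degree a; y carries
    them to all lower degrees. The MCM property holds because y acts as an inclusion, so y v = 0
    already forces v = 0. *)
Lemma model_C2 al M : has_model al M -> C2obj M.
Proof.
move=> [i [ri iF]]; have [iL iI iy ix] := ri.
split.
- by apply: (rep_grmod ri bar_t_lin) => n v; exact: bar_t_square.
- have [w wE] : exists w : gV M al.2, i _ w = (0, 1).
    by apply/iF; case: (al) => a b; rewrite in_bar01.
  have [us Hus] : exists us : seq {n : int & gV M n}, forall S, graded_submodule S ->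
      (forall g, List.In g us -> S (projT1 g) (projT2 g)) ->
      forall n (c : CC), le_end n al.1 || (c == 0) -> exists v, i n v = (c, 0) /\ S n v.
    case: al iF w wE => [[a|] b] iF w wE.
      have [u uE] : exists u : gV M a, i _ u = (1, 0) by apply/iF; rewrite in_bar10.
      exists [:: existT _ a u] => S sS /(_ (existT _ a u))/(_ (or_introl erefl)) /= Su n c.
      move=> nac; have [c0|c0] := eqVneq c 0.
        exists 0; rewrite (lin0 (iL n)) c0; split=> //; by case: sS.
      have na : n <= a by move: nac; rewrite /= (negbTE c0) orbF.
      have [v [vE Sv]] := submodule_down ri sS na Su.
      have [S0 SL _ _] := sS.
      exists (c *: v); split; last by rewrite -[_ *: _]addr0; exact: SL.
      rewrite (linZ (iL n)) vE uE; apply: CC2_eq => /=; first exact: mulr1.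
      exact: mulr0.
    exists [::] => S [S0 _ _ _] _ n c /= /eqP ->.
    by exists 0; rewrite (lin0 (iL n)).
  exists (existT _ al.2 w :: us) => S sS HS n v.
  have [v1 [E1 S1]] : exists v1, i n v1 = ((i n v).1, 0) /\ S n v1.
    apply: Hus => //; first by move=> g Hg; apply: HS; right.
    have : in_bar al n (i n v) by apply/iF; exists v.
    by rewrite /in_bar orbC => /andP[].
  have [S0 SL _ _] := sS.
  have [v2 [E2 S2]] : exists v2, i n v2 = (0, (i n v).2) /\ S n v2.
    have [c0|c0] := eqVneq (i n v).2 0.
      by exists 0; rewrite (lin0 (iL n)) c0.
    have nb : n <= al.2.
      have : in_bar al n (i n v) by apply/iF; exists v.
      by rewrite /in_bar (negbTE c0) /= => /andP[].
    have [u [uE Su]] := submodule_down ri sS nb (HS _ (or_introl erefl)).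
    exists ((i n v).2 *: u); split; last by rewrite -[_ *: _]addr0; exact: SL.
    rewrite (linZ (iL n)) uE /= wE; apply: CC2_eq => /=; first exact: mulr0.
    exact: mulr1.
  have -> : v = 1 *: v1 + v2.
    apply: iI; rewrite scale1r (linD (iL n)) E1 E2.
    by apply: CC2_eq; rewrite /= ?addr0 ?add0r.
  exact: SL.
- move=> n v xv yv; apply: iI; rewrite -iy yv.
  by rewrite !(lin0 (iL _)).
Qed.

(** * Splitting off a bar *)

Lemma max_int (P : int -> Prop) (B n0 : int) : P n0 -> (forall n, P n -> n < B) ->
  exists n, P n /\ forall m, n < m -> ~ P m.
Proof.
move=> P0 PB.
have [k Ek] : exists k : nat, B <= n0 + k%:Z by exists `|B - n0|%N; lia.
elim: k n0 P0 Ek => [|k IH] n0 P0 Ek; first by have := PB _ P0; lia.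
have [[m [n0m Pm]]|H] := classic (exists m, n0 < m /\ P m).
  by apply: (IH m) => //; lia.
by exists n0; split=> // m n0m Pm; apply: H; exists m.
Qed.

(** A zero coefficient puts no condition on the degree; this is the shape of the conditions in
    [in_barP]. *)
Lemma rep_scale M (V : lmodType CC) (t : V -> V) i (a : CC) n m (v : gV M m) :
  @rep M V t i -> (a != 0 -> n <= m) -> exists u : gV M n, i n u = a *: i m v.
Proof.
move=> r nm; have [iL _ _ _] := r; have [->|a0] := eqVneq a 0.
  by exists 0; rewrite scale0r (lin0 (iL n)).
have [u uE] := rep_down r v (nm a0).
by exists (a *: u); rewrite (linZ (iL n)) uE.
Qed.

Lemma rep_comb M (V : lmodType CC) (t : V -> V) i (a b : CC) n m l (v : gV M m) (w : gV M l) :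
  @rep M V t i -> (a != 0 -> n <= m) -> (b != 0 -> n <= l) ->
  exists u : gV M n, i n u = a *: i m v + b *: i l w.
Proof.
move=> r nm nl; have [iL _ _ _] := r.
have [u uE] := rep_scale v r nm; have [u' uE'] := rep_scale w r nl.
by exists (u + u'); rewrite (linD (iL n)) uE uE'.
Qed.

Lemma in_barP al n (w : CC2) :
  reflect ((w.1 != 0 -> le_end n al.1) /\ (w.2 != 0 -> n <= al.2)) (in_bar al n w).
Proof.
rewrite /in_bar; apply: (iffP andP) => -[].
  by move=> /orP[/eqP->|->] /orP[/eqP->|->]; rewrite ?eqxx.
by move=> H1 H2; split; case: eqP => //= /eqP; [exact: H1|exact: H2].
Qed.

Lemma in_bar_down al n m w : n <= m -> in_bar al m w -> in_bar al n w.
Proof.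
move=> nm /in_barP[H1 H2]; apply/in_barP; split=> [/H1|/H2]; last exact: le_trans.
by case: al.1 => //= a; exact: le_trans.
Qed.

Lemma valid_le al n : valid_arc al -> le_end n al.1 -> n <= al.2.
Proof. by case: al => [[a|] b] //= ab na; apply/ltW/(le_lt_trans na). Qed.

Lemma comb_lin (V : lmodType CC) (E1 E2 : V) : lin (fun w : CC2 => w.1 *: E1 + w.2 *: E2).
Proof.
by move=> a u v /=; rewrite !scalerDl scalerDr -!scalerA addrACA.
Qed.

(* Take n maximal with x M_n <> 0, e in M_n with x e <> 0, and m maximal with t e in M_m. A functional psi killing M_{m+1} with psi (t e) = 1 gives the retraction v |-> (psi (t v), psi v) onto the bar of e. If x = 0, any nonzero element of top degree spans a bar. *)
Lemma exists_model_summand M : C2obj M -> ~ is_zero M ->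
  exists al Z, [/\ valid_arc al, has_model al Z & summand Z M].
Proof.
move=> cM nzM; have [gM fM _] := cM.
have [V [t [i [gs [r tL _ gsT]]]]] := exists_rep cM.
have [iL iI iy ix] := r.
have [B HB] := bounded_above gM fM.
have [xL yL xx xy] := gM.
have i0 n v : i n v = 0 -> v = 0 by rewrite -(lin0 (iL n)) => /iI.
have tt n v : t (t (i n v)) = 0 by rewrite -!ix xx (lin0 (iL _)).
have [[n0 [v0 xv0]]|noX] := classic (exists n (v : gV M n), gx v <> 0).
  have [||n [[e xe] nmax]] := @max_int (fun n => exists v : gV M n, gx v <> 0) B n0.
  - by exists v0.
  - move=> n [v xv]; rewrite ltNge; apply/negP => Bn; apply: xv.
    by rewrite (HB _ v Bn) (lin0 (xL n)).
  pose w := t (i n e).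
  have w0 : w <> 0 by rewrite /w -ix => /i0.
  have tw : t w = 0 by exact: tt.
  have [||m [[f fE] mmax]] := @max_int (fun m => exists u : gV M m, i m u = w) B (n + 1).
  - by exists (gx e); rewrite ix.
  - move=> m [u uE]; rewrite ltNge; apply/negP => Bm; apply: w0.
    by rewrite -uE (HB _ u Bm) (lin0 (iL m)).
  (* The arc is valid because x e represents w in degree n + 1. *)
  have nm : n < m.
    rewrite ltNge; apply/negP => mn; apply: (mmax (n + 1)); first by lia.
    by exists (gx e); rewrite ix.
  have [|||psi [pL pS pw]] := @functional_extension V gs (fun v => exists u, i (m + 1) u = v) w gsT.
  - by exists 0; rewrite (lin0 (iL _)).
  - by move=> a u v [u' <-] [v' <-]; exists (a *: u' + v'); rewrite iL.
  - by apply: mmax; lia.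
  (* Since n < m, a multiple of w may be subtracted within degree n. This leaves t E = w and makes
     psi E = 0, so the retraction sends E exactly to (1, 0). *)
  pose E := i n e - psi (i n e) *: w.
  have [e' eE] : exists e' : gV M n, i n e' = E.
    have [u uE] := @rep_scale _ _ _ _ (- psi (i n e)) n m f r (fun _ => ltW nm).
    by exists (e + u); rewrite (linD (iL n)) uE fE scaleNr.
  have pE : psi E = 0.
    by rewrite (linB pL) (linZ pL) pw /= [_ *: _]mulr1 subrr.
  have tE : t E = w by rewrite (linB tL) (linZ tL) tw scaler0 subr0.
  have va : valid_arc (Some n, m) by [].
  have [Z /corresponds_has_model hZ] := exists_corresponds va.
  have [k [rk kF]] := hZ.
  have [] := @rep_hom _ _ _ _ _ _ _ _ (fun w' : CC2 => w'.1 *: E + w'.2 *: w) rk r.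
  - exact: comb_lin.
  - move=> l v /=; rewrite scale0r add0r (linD tL) !(linZ tL) tE tw.
    by rewrite scaler0 addr0.
  - move=> l v; rewrite -eE -fE.
    have /in_barP[/= H1 H2] : in_bar (Some n, m) l (k l v) by apply/kF; exists v.
    by have [u uE] := rep_comb e' f r H1 H2; exists u.
  move=> I [hI IE].
  have [] := @rep_hom _ _ _ _ _ _ _ _ (fun v => (psi (t v), psi v) : CC2) r rk.
  - by move=> a u v; rewrite tL !pL.
  - by move=> l v; rewrite tt (lin0 pL).
  (* The retraction respects degrees: above n one has x v = 0, so psi (t v) = 0; above m the
     functional psi vanishes by construction. *)
  - move=> l v; apply/kF/in_barP => /=; split=> H; rewrite leNgt; apply/negP => lt_l.
      have xv : gx v = 0 by apply: NNPP => xv; apply: (nmax l) => //; exists v.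
      by move: H; rewrite -ix xv (lin0 (iL _)) (lin0 pL) eqxx.
    have [|u uE] := @rep_down _ _ _ _ r (m + 1) l v; first by lia.
    by move: H; rewrite pS ?eqxx //; exists u.
  move=> Q [hQ QE]; exists (Some n, m), Z; split=> //; exists I, Q; split=> // l v.
  have [_ kI _ _] := rk; apply: kI; rewrite QE IE.
  rewrite (linD tL) !(linZ tL) tE tw scaler0 addr0 (linD pL) !(linZ pL) pE pw.
  by rewrite scaler0 add0r; apply: CC2_eq => /=; rewrite [LHS]mulr1.
have {noX} X0 n v : @gx M n v = 0 by apply: NNPP => H; apply: noX; exists n, v.
have [n0 [v0 v0nz]] : exists n (v : gV M n), v <> 0.
  apply: NNPP => H; apply: nzM => n v; apply: NNPP => Hv; apply: H; by exists n, v.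
have [||n [[e e0] nmax]] := @max_int (fun n => exists v : gV M n, v <> 0) B n0.
- by exists v0.
- move=> n [v vnz]; rewrite ltNge; apply/negP => Bn; apply: vnz; exact: HB.
pose w := i n e.
have w0 : w <> 0 by move=> /i0.
have tw : t w = 0 by rewrite /w -ix X0 (lin0 (iL _)).
have [|||psi [pL pS pw]] := @functional_extension V gs (fun v => v = 0) w gsT => //.
- by move=> a u v -> ->; rewrite scaler0 addr0.
have va : valid_arc (None, n) by [].
have [Z /corresponds_has_model hZ] := exists_corresponds va.
have [k [rk kF]] := hZ.
have k1 l v : (k l v).1 = 0.
  have /in_barP[/= H1 _] : in_bar (None, n) l (k l v) by apply/kF; exists v.
  by apply/eqP/negPn/negP => /H1.
have [] := @rep_hom _ _ _ _ _ _ _ _ (fun w' : CC2 => w'.1 *: 0 + w'.2 *: w) rk r.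
- exact: comb_lin.
- move=> l v /=; rewrite k1 !scale0r !add0r (linZ tL) tw.
  by rewrite ?scaler0.
- move=> l v; rewrite scaler0 add0r.
  have /in_barP[/= _ H2] : in_bar (None, n) l (k l v) by apply/kF; exists v.
  exact: rep_scale.
move=> I [hI IE].
have [] := @rep_hom _ _ _ _ _ _ _ _ (fun v => (0, psi v) : CC2) r rk.
- by move=> a u v; rewrite pL; apply: CC2_eq => //=; rewrite scaler0 addr0.
- by move=> l v; rewrite -ix X0 (lin0 (iL _)) (lin0 pL).
- move=> l v; apply/kF/in_barP => /=; rewrite eqxx; split=> // H; rewrite leNgt.
  apply/negP => lt_l.
  have v00 : v = 0 by apply: NNPP => xv; apply: (nmax l) => //; exists v.
  by move: H; rewrite v00 (lin0 (iL _)) (lin0 pL) eqxx.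
move=> Q [hQ QE]; exists (None, n), Z; split=> //; exists I, Q; split=> // l v.
have [_ kI _ _] := rk; apply: kI; rewrite QE IE scaler0 add0r (linZ pL) pw.
apply: CC2_eq => /=; first by rewrite k1.
by rewrite [LHS]mulr1.
Qed.

Lemma model_nonzero al M : has_model al M -> ~ is_zero M.
Proof.
move=> [i [[iL iI _ _] iF]] H.
have [w wE] : exists w : gV M al.2, i _ w = (0, 1).
  by apply/iF; case: (al) => a b; rewrite in_bar01.
by move: wE; rewrite (H _ w) (lin0 (iL _)) => -[] /eqP; rewrite eq_sym oner_eq0.
Qed.

Lemma dsum_zero_iso Z K : is_grmod K -> is_zero K -> iso (dsum Z K) Z.
Proof.
move=> gK K0; exists (@hfst Z K), (@hinl Z K); split=> //.
- exact: hom_inl.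
- by move=> n [a b]; rewrite /hfst /hinl /= (K0 _ b).
Qed.

Lemma indec_summand M Z : indecomposable M -> C2obj Z -> ~ is_zero Z -> summand Z M ->
  iso M Z.
Proof.
move=> [cM _ iM] cZ nZ sZ; have [gZ _ _] := cZ.
have [K [cK MK]] := summand_split gZ cM sZ; have [gK _ _] := cK.
have [//|K0] := iM _ _ cZ cK MK.
exact: iso_trans MK (dsum_zero_iso _ gK K0).
Qed.

(** The classification of indecomposables: a bar splits off, and by indecomposability it is the
    whole module. *)
Lemma indec_has_model M : indecomposable M -> exists al, valid_arc al /\ has_model al M.
Proof.
move=> iM; have [cM nM _] := iM.
have [al [Z [va mZ sZ]]] := exists_model_summand cM nM.
exists al; split=> //; apply: iso_model (mZ); apply: iso_sym.
by apply: indec_summand => //; [exact: model_C2 mZ|exact: model_nonzero mZ].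
Qed.

Lemma rep_comp X E (V : lmodType CC) (t : V -> V) k (j : forall n, gV X n -> gV E n) :
  @rep E V t k -> is_hom j -> (forall n, injective (j n)) ->
  rep t (fun n v => k n (j n v)).
Proof.
move=> [kL kI ky kx] [jL jx jy] jI; split.
- by move=> n a u v; rewrite jL kL.
- by move=> n u v /kI /jI.
- by move=> n v; rewrite jy ky.
- by move=> n v; rewrite jx kx.
Qed.

Lemma hinl_inj X Y n : injective (@hinl X Y n).
Proof. by move=> u v []. Qed.
Lemma hinr_inj X Y n : injective (@hinr X Y n).
Proof. by move=> u v []. Qed.

Lemma dsumC X Y : iso (dsum X Y) (dsum Y X).
Proof.
exists (fun n v => (v.2, v.1)), (fun n v => (v.2, v.1)).
by split=> [||n [a b]|n [a b]] //; split.
Qed.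

Lemma nonzero_elt M : ~ is_zero M -> exists n (v : gV M n), v <> 0.
Proof.
move=> nz; apply: NNPP => H; apply: nz => n v; apply: NNPP => Hv.
by apply: H; exists n, v.
Qed.

(** * Indecomposability *)

Section Rank.
Variables (X Y : GrData) (V : lmodType CC) (t : V -> V) (k : forall n, gV (dsum X Y) n -> V).
Hypotheses (gX : is_grmod X) (gY : is_grmod Y) (rk : rep t k).

Let rX := rep_comp rk (hom_inl X gY) (@hinl_inj X Y).
Let rY := rep_comp rk (hom_inr Y gX) (@hinr_inj X Y).

(** Nonzero elements of X and Y, moved to a common degree by y, would be two independent vectors on
    a line. *)
Lemma rank1_dsum A0 : (forall n v, spanned [:: A0] (@k n v)) -> is_zero X \/ is_zero Y.
Proof.
move=> sp; apply: NNPP => /not_or_and[/nonzero_elt[n [a a0]] /nonzero_elt[m [b b0]]].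
pose q := Num.min n m.
have [|a' aE] := @rep_down _ _ _ _ rX q n a; first by lia.
have [|b' bE] := @rep_down _ _ _ _ rY q m b; first by lia.
have [kL kI _ _] := rk; have [kLX kIX _ _] := rX; have [kLY kIY _ _] := rY.
have a'0 : a' <> 0.
  by move=> E; apply: a0; apply: kIX; rewrite -aE E !(lin0 (kLX _)).
have b'0 : b' <> 0.
  by move=> E; apply: b0; apply: kIY; rewrite -bE E !(lin0 (kLY _)).
have [|i|c [[i ci]]] := @spanned_dependent V [:: A0] 2
    (fun i => if val i == 0%N then k (hinl Y a') else k (hinr X b')) => //.
  by case: ifP.
rewrite !big_ord_recl big_ord0 addr0 /= -!(linZ (kL q)) -(linD (kL q)).
rewrite -[RHS](lin0 (kL q)) => /kI [].
rewrite scaler0 addr0 scaler0 add0r => /eqP + /eqP.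
rewrite !scaler_eq0 => /orP[/eqP c0|/eqP//] /orP[/eqP c1|/eqP//].
case: i ci => [[|[|//]] lt_i]; move/eqP; apply.
  by rewrite -[RHS]c0; congr c; exact: val_inj.
by rewrite -[RHS]c1; congr c; exact: val_inj.
Qed.

(** If x a is nonzero for some a in X, then a, t a and a nonzero element of Y are three independent
    vectors in a plane; applying t to a relation isolates the coefficient of a. *)
Lemma rank2_dsum A0 B0 : lin t -> (forall n v, spanned [:: A0; B0] (@k n v)) -> ~ is_zero Y ->
  forall n (v : gV X n), gx v = 0.
Proof.
move=> tL sp /nonzero_elt[m [b b0]] n a; apply: NNPP => xa.
pose q := Num.min n m.
have [|a' aE] := @rep_down _ _ _ _ rX q n a; first by lia.
have [|a'' aE'] := @rep_down _ _ _ _ rX q _ (gx a); first by lia.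
have [|b' bE] := @rep_down _ _ _ _ rY q m b; first by lia.
have [kL kI _ _] := rk; have [kLX kIX kyX kxX] := rX; have [kLY kIY _ _] := rY.
have a'0 : a'' <> 0.
  by move=> E; apply: xa; apply: kIX; rewrite -aE' E !(lin0 (kLX _)).
have b'0 : b' <> 0.
  by move=> E; apply: b0; apply: kIY; rewrite -bE E !(lin0 (kLY _)).
have [|i|c [[i ci]]] := @spanned_dependent V [:: A0; B0] 3
    (fun i => if val i == 0%N then k (hinl Y a') else
              if val i == 1%N then k (hinl Y a'') else k (hinr X b')) => //.
  by do 2!case: ifP => // _.
rewrite !big_ord_recl big_ord0 addr0 /= -!(linZ (kL q)) -!(linD (kL q)).
rewrite -[RHS](lin0 (kL q)) => /kI [].
rewrite !scaler0 addr0 !add0r => E /eqP.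
rewrite scaler_eq0 => /orP[/eqP c2|/eqP//].
have t2 : t (k (hinl Y a'')) = 0.
  by have [_ _ xx _] := gX; rewrite aE' -kxX xx (lin0 (kLX _)).
have t1 : t (k (hinl Y a')) = k (hinl Y a'') by rewrite aE -kxX aE'.
have Ek := f_equal (fun v => k (hinl Y v)) E.
have := f_equal t Ek; rewrite (lin0 (kLX q)) (lin0 tL) (linD (kLX q)) !(linZ (kLX q)).
rewrite (linD tL) !(linZ tL) t1 t2 scaler0 addr0 => /eqP.
rewrite scaler_eq0 => /orP[/eqP c0|/eqP]; last first.
  by rewrite -(lin0 (kLX q)) => /kIX.
move/eqP: E; rewrite c0 scale0r add0r scaler_eq0 => /orP[/eqP c1|/eqP//].
case: i ci => [[|[|[|//]]] lt_i]; move/eqP; apply.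
- by rewrite -[RHS]c0; congr c; exact: val_inj.
- by rewrite -[RHS]c1; congr c; exact: val_inj.
- by rewrite -[RHS]c2; congr c; exact: val_inj.
Qed.
End Rank.

Lemma iso_rep X E (V : lmodType CC) (t : V -> V) k : @rep E V t k -> iso E X ->
  exists j : forall n, gV X n -> gV E n, is_hom j /\ rep t (fun n v => k n (j n v)).
Proof.
move=> rk [f [g [hf hg gf fg]]]; exists g; split=> //.
apply: rep_comp => // n; exact: can_inj (fg n).
Qed.

Lemma rank1_indec E (V : lmodType CC) (t : V -> V) k A0 : C2obj E -> ~ is_zero E ->
  @rep E V t k -> (forall n v, spanned [:: A0] (k n v)) -> indecomposable E.
Proof.
move=> cE nE rk sp; split=> // A B [gA _ _] [gB _ _] EAB.
have [j [hj rj]] := iso_rep rk EAB.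
exact: (rank1_dsum gA gB rj).
Qed.

(** In a decomposition with both parts nonzero, x would vanish on each part and therefore on E. The
    criterion serves the finite bars as well as the non-split extensions between infinite ones. *)
Lemma rank2_indec E (V : lmodType CC) (t : V -> V) k A0 B0 : C2obj E -> lin t ->
  @rep E V t k -> (forall n v, spanned [:: A0; B0] (k n v)) ->
  (exists n (v : gV E n), gx v <> 0) -> indecomposable E.
Proof.
move=> cE tL rk sp [n0 [v0 xv0]]; have [[xL _ _ _] _ _] := cE.
have nE : ~ is_zero E by move=> E0; apply: xv0; rewrite (E0 _ v0) (lin0 (xL _)).
split=> //.
move=> A B [gA _ _] [gB _ _] EAB; apply: NNPP => /not_or_and[nA nB]; apply: xv0.
have [j [hj rj]] := iso_rep rk EAB.
have [j' [hj' rj']] := iso_rep rk (iso_trans EAB (dsumC A B)).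
have xA := rank2_dsum gA gB rj tL (fun n v => sp n (j n v)) nB.
have xB := rank2_dsum gB gA rj' tL (fun n v => sp n (j' n v)) nA.
have [f [g [[_ fx _] hg gf fg]]] := EAB.
rewrite -[LHS]gf fx /= xA xB.
by have [gL _ _] := hg; rewrite -[RHS](lin0 (gL _)).
Qed.

Lemma model_indec al M : has_model al M -> indecomposable M.
Proof.
move=> mM; have cM := model_C2 mM; have nM := model_nonzero mM.
case: al mM => [[a|] b] [i [ri iF]].
  apply: (@rank2_indec M _ bar_t i ((1, 0) : CC2) ((0, 1) : CC2)) => //.
  - exact: bar_t_lin.
  - move=> n v /=; exists (i n v).1, (i n v).2; apply: CC2_eq => /=.
      by rewrite [_ *: 1]mulr1 subrr [_ *: 0]mulr0 subrr.
    by rewrite [_ *: 1]mulr1 [_ *: 0]mulr0 subr0 subrr.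
  have [u uE] : exists u : gV M a, i _ u = (1, 0) by apply/iF; rewrite in_bar10.
  have [iL _ _ ix] := ri.
  exists a, u => /(f_equal (i _)); rewrite ix uE (lin0 (iL _)) => -[] /eqP.
  by rewrite oner_eq0.
apply: (@rank1_indec M _ bar_t i ((0, 1) : CC2)) => //.
move=> n v /=; exists (i n v).2.
have /in_barP[/= H1 _] : in_bar (None, b) n (i n v) by apply/iF; exists v.
apply: CC2_eq => /=; last by rewrite [_ *: 1]mulr1 subrr.
by rewrite [_ *: 0]mulr0 subr0; apply/eqP/negPn/negP => /H1.
Qed.

(** * Homomorphisms out of a bar *)

Lemma hom_part M N (V W : lmodType CC) (t : V -> V) (s : W -> W) i k
    (f : forall n, gV M n -> gV N n) n m (v : gV M m) (c : CC) :
  @rep M V t i -> @rep N W s k -> is_hom f -> (c != 0 -> n <= m) ->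
  exists u : gV M n, i n u = c *: i m v /\ k n (f n u) = c *: k m (f m v).
Proof.
move=> ri rk hf nm; have [iL _ _ _] := ri; have [kL _ _ _] := rk; have [fL _ _] := hf.
have [->|c0] := eqVneq c 0.
  by exists 0; rewrite !scale0r (lin0 (iL n)) (lin0 (fL n)) (lin0 (kL n)).
have [u uE] := rep_down ri v (nm c0).
exists (c *: u); rewrite (linZ (iL n)) (linZ (fL n)) (linZ (kL n)) uE.
by rewrite (hom_single_valued ri rk hf uE).
Qed.

(** [E1] and [E2] are the images of e and t e. For an infinite arc e is absent, and [E1 = 0] is a
    placeholder that lets both kinds of arcs share one formula. *)
Lemma model_to_rep al M i E (V : lmodType CC) (t : V -> V) k (f : forall n, gV M n -> gV E n) :
  @model al M i -> @rep E V t k -> lin t -> is_grmod E -> is_hom f ->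
  exists E1 E2 : V, [/\ forall n v, k n (f n v) = (i n v).1 *: E1 + (i n v).2 *: E2,
    exists w : gV M al.2, i _ w = (0, 1) /\ k _ (f _ w) = E2, t E2 = 0
    & if al.1 is Some a then t E1 = E2 /\ exists u : gV M a, i _ u = (1, 0) /\ k _ (f _ u) = E1
      else E1 = 0].
Proof.
move=> [ri iF] rk tL gE hf.
have [iL iI iy ix] := ri; have [kL kI ky kx] := rk; have [fL fx fy] := hf.
have [w wE] : exists w : gV M al.2, i _ w = (0, 1).
  by apply/iF; case: (al) => a b; rewrite in_bar01.
have sv := hom_single_valued ri rk hf.
have part n m (v : gV M m) (c : CC) (h : c != 0 -> n <= m) := hom_part v ri rk hf h.
have tw : t (k _ (f _ w)) = 0.
  rewrite -kx -fx.
  have -> : gx w = 0 by apply: iI; rewrite ix wE (lin0 (iL _)).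
  by rewrite (lin0 (fL _)) (lin0 (kL _)).
have FF n v : in_bar al n (i n v) by apply/iF; exists v.
have split2 n v c : (exists u : gV M n, i n u = ((i n v).1, 0) /\ k n (f n u) = c) ->
   k n (f n v) = c + (i n v).2 *: k al.2 (f al.2 w).
  move=> [u [uE <-]].
  have /in_barP[_ /part H2] := FF n v; have [u2 [u2E <-]] := H2 w.
  rewrite -(linD (kL n)) -(linD (fL n)); congr (k n (f n _)); apply: iI.
  rewrite (linD (iL n)) uE u2E wE; apply: CC2_eq => /=.
    by rewrite [_ *: 0]mulr0 addr0.
  by rewrite [_ *: 1]mulr1 add0r.
case: al iF w wE tw FF split2 => [[a|] b] iF w wE tw FF split2 /=.
  have [u uE] : exists u : gV M a, i _ u = (1, 0) by apply/iF; rewrite in_bar10.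
  exists (k _ (f _ u)), (k _ (f _ w)); split=> //; last 2 first.
  - by exists w.
  - split; last by exists u.
    rewrite -kx -fx; apply: sv; rewrite ix uE wE //.
  move=> n v; apply: split2.
  have /in_barP[/= /part H1 _] := FF n v; have [u1 [u1E <-]] := H1 u.
  exists u1; split=> //; rewrite u1E uE; apply: CC2_eq => /=; first exact: mulr1.
  exact: mulr0.
exists 0, (k _ (f _ w)); split=> //; last by exists w.
move=> n v; rewrite scaler0; apply: split2; exists 0.
rewrite (lin0 (iL n)) (lin0 (fL n)) (lin0 (kL n)); split=> //.
have /in_barP[/= H1 _] := FF n v.
by have /eqP-> : (i n v).1 == 0 by apply/negPn/negP => /H1.
Qed.

Lemma model_endo al M i (f : forall n, gV M n -> gV M n) : @model al M i -> is_hom f ->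
  exists alpha beta : CC, forall n v,
    i n (f n v) = (alpha * (i n v).1, beta * (i n v).1 + alpha * (i n v).2).
Proof.
move=> mM hf; have [ri iF] := mM.
have [gM _ _] : C2obj M by apply: (@model_C2 al); exists i.
have [E1 [E2 [fE [w [wE wE2]] _ H]]] := model_to_rep mM ri bar_t_lin gM hf.
have k1 n v : al.1 = None -> (i n v).1 = 0.
  have /in_barP[/= H1 _] : in_bar al n (i n v) by apply/iF; exists v.
  by move=> al0; apply/eqP/negPn/negP => /H1; rewrite al0.
case Eal: al.1 H => [a|].
  move=> [tE1 _]; exists E1.1, E1.2 => n v; rewrite fE -tE1; apply: CC2_eq => /=.
    by rewrite scaler0 addr0; exact: mulrC.
  by rewrite [_ *: E1.2]mulrC [_ *: E1.1]mulrC.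
move=> E10; exists E2.2, 0 => n v; rewrite fE E10 scaler0 add0r; apply: CC2_eq => /=.
  by rewrite -wE2 !k1 // scaler0 mulr0.
by rewrite mul0r add0r; exact: mulrC.
Qed.

(* Endomorphisms of a bar are alpha + beta t, so the endomorphism ring is local; this replaces Krull-Schmidt. *)
Lemma model_auto al M i (f : forall n, gV M n -> gV M n) (alpha beta : CC) :
  valid_arc al -> @model al M i -> is_hom f -> alpha != 0 ->
  (forall n v, i n (f n v) = (alpha * (i n v).1, beta * (i n v).1 + alpha * (i n v).2)) ->
  exists g : forall n, gV M n -> gV M n, is_hom g /\ forall n v, g n (f n v) = v.
Proof.
move=> va mM hf a0 fE.
(* The inverse of alpha + beta t. It preserves the filtration because the arc is valid: a < b puts t
   e in every level that contains e. *)
pose phi (w : CC2) : CC2 := (alpha^-1 * w.1, alpha^-1 * (w.2 - beta * (alpha^-1 * w.1))).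
have [] := @model_hom _ _ _ _ _ _ phi mM mM.
- have sM (x y : CC) : x *: (y : CC^o) = x * y by [].
  by move=> a u v; apply: CC2_eq; rewrite /phi /= !sM; ring.
- by move=> n v; apply: CC2_eq; rewrite /phi /= ?mulr0 ?subr0.
- move=> n w /in_barP[H1 H2]; apply/in_barP; rewrite /phi /=; split.
    by rewrite mulf_eq0 negb_or => /andP[_]; exact: H1.
  have [w10|/H1] := eqVneq w.1 0.
    by rewrite w10 !mulr0 subr0 mulf_eq0 negb_or => /andP[_]; exact: H2.
  by move: va; case: (al) => [[a|] b] //; rewrite /valid_arc /=; lia.
move=> g [hg gE]; exists g; split=> // n v.
have [[_ iI _ _] _] := mM; apply: iI; rewrite gE fE /phi /=.
by apply: CC2_eq => /=; rewrite mulKf // addrC addKr mulKf.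
Qed.

(** The identity of Z is the sum of an endomorphism through X and one through Y. Their diagonal
    scalars add up to 1, so one of them is nonzero and that endomorphism can be inverted. *)
Lemma summand_dsum Z X Y : indecomposable Z -> is_grmod X -> is_grmod Y ->
  summand Z (dsum X Y) -> summand Z X \/ summand Z Y.
Proof.
move=> iZ gX gY [i [p [hi hp pi_id]]].
have [al [va [k mk]]] := indec_has_model iZ.
pose f := hcomp p (hcomp (@hinl X Y) (hcomp (@hfst X Y) i)).
pose g := hcomp p (hcomp (@hinr X Y) (hcomp (@hsnd X Y) i)).
have hf : is_hom f by do !apply: hom_comp => //; exact: hom_inl.
have hg : is_hom g by do !apply: hom_comp => //; exact: hom_inr.
have fg n v : f n v + g n v = v.
  have [pL _ _] := hp; rewrite /f /g /hcomp -(linD (pL n)) -[RHS]pi_id; congr p.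
  by case: (i n v) => a b; rewrite -[LHS]/(a + 0, 0 + b) addr0 add0r.
have [a [b fE]] := model_endo mk hf.
have [a' [b' gE]] := model_endo mk hg.
have aa : a + a' = 1.
  have [[kL _ _ _] kF] := mk.
  have [w wE] : exists w : gV Z al.2, k _ w = (0, 1).
    by apply/kF; case: (al) => c d; rewrite in_bar01.
  have := f_equal (k _) (fg _ w); rewrite (linD (kL _)) fE gE wE => -[_ <-].
  by rewrite !mulr0 !mulr1 !add0r.
have [a0|a0] := eqVneq a 0.
  right; have a'0 : a' != 0 by move: aa; rewrite a0 add0r => ->; exact: oner_neq0.
  have [h [hh hE]] := model_auto va mk hg a'0 gE.
  exists (hcomp (@hsnd X Y) i), (hcomp h (hcomp p (@hinr X Y))).
  split; [by apply: hom_comp|by do !apply: hom_comp => //; exact: hom_inr|exact: hE].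
left; have [h [hh hE]] := model_auto va mk hf a0 fE.
exists (hcomp (@hfst X Y) i), (hcomp h (hcomp p (@hinl X Y))).
by split; [by apply: hom_comp|by do !apply: hom_comp => //; exact: hom_inl|exact: hE].
Qed.

(** * Extensions and crossings *)

Lemma model_incl al be M N i k : @model al M i -> @model be N k ->
  (forall n w, in_bar al n w -> in_bar be n w) ->
  exists f : forall n, gV M n -> gV N n, is_hom f /\ forall n v, k n (f n v) = i n v.
Proof. by move=> mM mN H; apply: (@model_hom _ _ _ _ _ _ id mM mN). Qed.

Lemma almost_compatible_sym M N : almost_compatible M N -> almost_compatible N M.
Proof. by case=> -[H1 H2]; [left|right]. Qed.

(* Viewed inside the same plane, (a, b) and (c, d) are the intersection and the sum of (c, b) and (a, d), whence a Mayer-Vietoris extension with middle term (c, b) + (a, d). *)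
Lemma crossing_not_compatible a b c d M N :
  lt_end a (Some c) -> c < b -> b < d -> has_model (a, b) M -> has_model (Some c, d) N ->
  ~ almost_compatible M N.
Proof.
move=> ac cb bd [iM mM] [iN mN].
have vX : valid_arc (Some c, b) by [].
have vY : valid_arc (a, d) by rewrite /valid_arc /=; case: (a) ac => //= a'; lia.
have [X cX] := exists_corresponds vX; have hX := corresponds_has_model cX.
have [Y cY] := exists_corresponds vY; have hY := corresponds_has_model cY.
have [C2X C2Y] := (model_C2 hX, model_C2 hY).
have [nX nY] := (model_nonzero hX, model_nonzero hY).
case: hX hY => [iX mX] [iY mY].
have aTc n : le_end n a -> n <= c by case: (a) ac => //= a'; lia.
have [f1 [hf1 f1E]] : exists f : forall n, gV M n -> gV X n,
    is_hom f /\ forall n v, iX n (f n v) = iM n v.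
  apply: (model_incl mM mX) => n w /in_barP[/= H1 H2]; apply/in_barP.
  by split=> // /H1 /aTc.
have [f2 [hf2 f2E]] : exists f : forall n, gV M n -> gV Y n,
    is_hom f /\ forall n v, iY n (f n v) = iM n v.
  apply: (model_incl mM mY) => n w /in_barP[/= H1 H2]; apply/in_barP.
  by split=> // /H2 /=; lia.
have [g1 [hg1 g1E]] : exists f : forall n, gV X n -> gV N n,
    is_hom f /\ forall n v, iN n (f n v) = iX n v.
  apply: (model_incl mX mN) => n w /in_barP[/= H1 H2]; apply/in_barP.
  by split=> // /H2 /=; lia.
have [g2 [hg2 g2E]] : exists f : forall n, gV Y n -> gV N n,
    is_hom f /\ forall n v, iN n (f n v) = iY n v.
  apply: (model_incl mY mN) => n w /in_barP[/= H1 H2]; apply/in_barP.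
  by split=> // /H1 /aTc.
have [[MI MInj My Mx] MF] := mM; have [[NI NInj Ny Nx] NF] := mN.
have [[XI XInj Xy Xx] XF] := mX; have [[YI YInj Yy Yx] YF] := mY.
have [f1L f1x f1y] := hf1; have [f2L f2x f2y] := hf2.
have [g1L g1x g1y] := hg1; have [g2L g2x g2y] := hg2.
have [[NxL NyL _ _] _ _] : C2obj N by apply: (@model_C2 (Some c, d)); exists iN.
pose f n (v : gV M n) : gV (dsum X Y) n := (f1 n v, f2 n v).
pose g n (v : gV (dsum X Y) n) : gV N n := g1 n v.1 - g2 n v.2.
have gE n v : iN n (g n v) = iX n v.1 - iY n v.2.
  by rewrite /g (linB (NI n)) g1E g2E.
have cfl : conflation f g.
  split.
  - exact: dsum_C2.
  - split; split.
    + by move=> n z u v; rewrite /f f1L f2L.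
    + by move=> n v; rewrite /f f1x f2x.
    + by move=> n v; rewrite /f f1y f2y.
    + move=> n z u v; rewrite /g [X in X - _](g1L n z u.1 v.1) [X in _ - X](g2L n z u.2 v.2).
      by rewrite opprD addrACA scalerBr.
    + by move=> n v; rewrite /g (linB (NxL n)) -g1x -g2x.
    + by move=> n v; rewrite /g (linB (NyL n)) -g1y -g2y.
  - by move=> n u v [/(f_equal (iX n)) E _]; apply: MInj; rewrite -!f1E.
  - move=> n w.
    have /in_barP[/= H1 H2] : in_bar (Some c, d) n (iN n w) by apply/NF; exists w.
    (* Up to degree b the element lifts to X. Beyond b, hence beyond c, it has no e-coordinate and
       lifts to Y, with the sign coming from the difference in g. *)
    have [nb|bn] := leP n b.
      have [u uE] : exists u, iX n u = iN n w by apply/XF/in_barP.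
      exists (u, 0); apply: NInj; rewrite gE /= uE.
      by rewrite (lin0 (YI n)) subr0.
    have [v vE] : exists v, iY n v = - iN n w.
      apply/YF/in_barP; rewrite /= !oppr_eq0; split=> // /H1; lia.
    exists (0, v); apply: NInj; rewrite gE /= vE.
    by rewrite (lin0 (XI n)) opprK add0r.
  - move=> n [u v]; split=> [gv|[m <-]]; last first.
      by apply: NInj; rewrite gE f1E f2E subrr (lin0 (NI n)).
    have /eqP : iX n u - iY n v = 0 by rewrite -[LHS](gE n (u, v)) gv (lin0 (NI n)).
    rewrite subr_eq0 => /eqP uv.
    have /in_barP[_ Hu] : in_bar (Some c, b) n (iX n u) by apply/XF; exists u.
    have /in_barP[Hv _] : in_bar (a, d) n (iY n v) by apply/YF; exists v.
    have [m mE] : exists m, iM n m = iX n u.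
      by apply/MF/in_barP; split=> //=; rewrite uv; exact: Hv.
    exists m; rewrite /f; congr (_, _); first by apply: XInj; rewrite f1E.
    by apply: YInj; rewrite f2E mE.
(* A section would send e to a pair without e-coordinates: in X because t of it lies in level d > b,
   in Y because e is missing in degree c > a. But g must return e. *)
have nsplit : ~ split_epi g.
  move=> [s [hs gs]].
  have hs1 : is_hom (hcomp (@hfst X Y) s) by apply: hom_comp.
  have [s1L s1x s1y] := hs1.
  have [u uE] : exists u : gV N c, iN _ u = (1, 0) by apply/NF; rewrite in_bar10.
  have [w wE] : exists w : gV N d, iN _ w = (0, 1) by apply/NF; rewrite in_bar01.
  have [[rN _] [rX _]] := (mN, mX).
  have E1 : bar_t (iX _ (s _ u).1) = iX _ (s _ w).1.
    rewrite -Xx -[gx _](s1x c u); apply: (hom_single_valued rN rX hs1).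
    by rewrite Nx uE wE.
  have /in_barP[_ /= H1] : in_bar (Some c, b) d (iX _ (s _ w).1) by apply/XF; exists (s _ w).1.
  have /in_barP[/= H2 _] : in_bar (a, d) c (iY _ (s _ u).2) by apply/YF; exists (s _ u).2.
  have X0 : (iX _ (s _ u).1).1 = 0.
    by apply/eqP/negPn/negP => H; move: H1; rewrite -E1 => /(_ H); lia.
  have Y0 : (iY _ (s _ u).2).1 = 0.
    by apply/eqP/negPn/negP => /H2; case: (a) ac => //= a'; lia.
  have := f_equal (iN _) (gs _ u); rewrite gE uE => /(f_equal fst) /=.
  by rewrite X0 Y0 subrr => /eqP; rewrite eq_sym oner_eq0.
case=> -[H _]; first exact: nsplit (H _ _ _ cfl).
have [_ _ /(_ X Y C2X C2Y (iso_refl _))] := H _ _ _ cfl nsplit.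
by case.
Qed.

(** A bar is presented by its two basis vectors, in their levels, with t e = f and t f = 0, so lifts
    [A] and [B] obeying these relations define a section. For an infinite arc [A = 0] stands for the
    missing lift. *)
Lemma split_criterion be N iN E (V : lmodType CC) (t : V -> V) k
    (g : forall n, gV E n -> gV N n) (A B : V) :
  @model be N iN -> @rep E V t k -> lin t -> is_hom g -> t B = 0 ->
  (exists f : gV E be.2, k _ f = B /\ iN _ (g _ f) = (0, 1)) ->
  (if be.1 is Some c then t A = B /\ exists e : gV E c, k _ e = A /\ iN _ (g _ e) = (1, 0)
   else A = 0) -> split_epi g.
Proof.
move=> mN rk tL hg tB [f [fB gf]] HA.
have [rN NF] := mN; have [NI NInj Ny Nx] := rN.
have [kL kI ky kx] := rk; have [gL gX gY] := hg.
have FF n v : in_bar be n (iN n v) by apply/NF; exists v.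
have partA n (c : CC) : (c != 0 -> le_end n be.1) ->
    exists u : gV E n, k n u = c *: A /\ iN n (g n u) = (c, 0).
  case: be.1 HA => [a|] /=; last first.
    move=> -> c0; exists 0; rewrite (lin0 (kL n)) (lin0 (gL n)) (lin0 (NI n)) scaler0.
    by split=> //; have /eqP-> : c == 0 by apply/negPn/negP => /c0.
  move=> [_ [e [<- ge]]] /(hom_part e rk rN hg) [u [uE guE]]; exists u; split=> //.
  rewrite guE ge; apply: CC2_eq => /=; first exact: mulr1.
  exact: mulr0.
have [] := @rep_hom _ _ _ _ _ _ _ _ (fun w : CC2 => w.1 *: A + w.2 *: B) rN rk.
- exact: comb_lin.
- move=> n v /=; rewrite scale0r add0r (linD tL) !(linZ tL) tB scaler0 addr0.
  have /in_barP[H1 _] := FF n v.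
  case: be.1 HA H1 => [c [-> _] //|_ /= H1].
  by have /eqP-> : (iN n v).1 == 0 by [apply/negPn/negP => /H1]; rewrite !scale0r.
- move=> n v; have /in_barP[/partA[u [uE _]]] := FF n v.
  move=> /(hom_part f rk rN hg) [u' [uE' _]].
  by exists (u + u'); rewrite (linD (kL n)) uE uE' fB.
move=> s [hs sE]; exists s; split=> // n w; apply: NInj.
have /in_barP[/partA[u [uE guE]]] := FF n w.
move=> /(hom_part f rk rN hg) [u' [uE' guE']].
have -> : s n w = u + u' by apply: kI; rewrite sE (linD (kL n)) uE uE' fB.
rewrite (linD (gL n)) (linD (NI n)) guE guE' gf; apply: CC2_eq => /=.
  by rewrite [_ *: 0]mulr0 addr0.
by rewrite [_ *: 1]mulr1 add0r.
Qed.

(** Each implication excludes one of the two crossing patterns, in the form in which it later places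
    a correction term in level d. *)
Lemma noncross_finite al c d : ~~ cross al (Some c, d) ->
  [/\ le_end (c + 1) al.1 -> d + 1 <= al.2 -> le_end d al.1
    & ~~ le_end c al.1 -> c + 1 <= al.2 -> d <= al.2].
Proof.
case: al => a b; rewrite /cross negb_or => /andP[H1 H2] /=; split.
  by case: a H1 H2 => [a|] //=; lia.
by case: a H1 H2 => [a|] /=; lia.
Qed.

(* Lift the generators of N to E and measure the failure of the relations t e = f and t f = 0 by vectors of M; in the absence of a crossing these are absorbed by changing the lifts within M. Only between two infinite arcs may t f survive, and then E has rank two with x <> 0. *)
Lemma noncross_extension al be M N E f g : valid_arc al -> valid_arc be ->
  ~~ cross al be -> has_model al M -> has_model be N -> @conflation M E N f g ->
  split_epi g \/ indecomposable E.
Proof.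
move=> va vb ncr [iM mM] [iN mN] [cE [hf hg] fI gS ex].
have [V [t [k [_ [rk tL _ _]]]]] := exists_rep cE.
have [gE _ _] := cE; have [xL yL xx xy] := gE.
have [E1 [E2 [fE _ tE2 HE]]] := model_to_rep mM rk tL gE hf.
have [rM MF] := mM; have [MI MInj My Mx] := rM.
have [rN NF] := mN; have [NI NInj Ny Nx] := rN.
have [kL kI ky kx] := rk; have [gL gX gY] := hg; have [fL _ _] := hf.
have FN n v : in_bar be n (iN n v) by apply/NF; exists v.
have FM n v : in_bar al n (iM n v) by apply/MF; exists v.
have tt n v : t (t (k n v)) = 0 by rewrite -!kx xx (lin0 (kL _)).
have kerE n v : g n v = 0 -> exists w : CC2, in_bar al n w /\ k n v = w.1 *: E1 + w.2 *: E2.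
  by move=> /ex[m <-]; exists (iM n m); rewrite fE.
have inE n w : in_bar al n w -> exists m, k n (f n m) = w.1 *: E1 + w.2 *: E2.
  by move=> /MF[m <-]; exists m.
have indep n (w : CC2) : in_bar al n w -> w.1 *: E1 + w.2 *: E2 = 0 -> w = 0.
  move=> /MF[m <-]; rewrite -fE -(lin0 (kL n)) => /kI.
  by rewrite -(lin0 (fL n)) => /fI ->; rewrite (lin0 (MI n)).
have gf n m : g n (f n m) = 0 by apply/ex; exists m.
have tcomb n (w : CC2) : in_bar al n w -> t (w.1 *: E1 + w.2 *: E2) = w.1 *: E2.
  move=> /in_barP[H1 _]; rewrite (linD tL) !(linZ tL) tE2 scaler0 addr0.
  case: al.1 HE H1 => [a [-> _] //|_ /= H1].
  by have /eqP-> : w.1 == 0 by [apply/negPn/negP => /H1]; rewrite !scale0r.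
have [f1 f1E] : exists v : gV N be.2, iN _ v = (0, 1).
  by apply/NF; case: (be) => c d; rewrite in_bar01.
have [f0 f0E] := gS _ f1.
have single := hom_single_valued rk rN hg.
have [w' [Fw' w'E]] : exists w : CC2, in_bar al (be.2 + 1) w /\
    t (k _ f0) = w.1 *: E1 + w.2 *: E2.
  rewrite -kx; apply: kerE; rewrite gX f0E; apply: NInj.
  by rewrite Nx f1E (lin0 (NI _)).
case: be vb ncr mN NF FN f1 f1E f0 f0E Fw' w'E => [[c|] d] vb ncr mN NF FN f1 f1E f0 f0E /= Fw' w'E.
  left; have cd : c < d by [].
  have [e1 e1E] : exists v : gV N c, iN _ v = (1, 0) by apply/NF; rewrite in_bar10.
  have [e0 e0E] := gS _ e1.
  have [|f0' f0'E] := @rep_down _ _ _ _ rk (c + 1) d f0; first by lia.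
  have [w [Fw wE]] : exists w : CC2, in_bar al (c + 1) w /\
      t (k _ e0) - k _ f0 = w.1 *: E1 + w.2 *: E2.
    rewrite -kx -f0'E -(linB (kL _)); apply: kerE; apply: NInj.
    rewrite (linB (gL _)) (linB (NI _)) gX Nx (single _ _ _ _ f0'E) e0E f0E e1E f1E.
    by rewrite subrr (lin0 (NI _)).
  have Fw'' : in_bar al (c + 1) (w'.1, w'.2 + w.1).
    have cd1 : c + 1 <= d + 1 by rewrite lerD2r ltW.
    have /in_barP[H1 H2] := in_bar_down cd1 Fw'; have /in_barP[H3 _] := Fw; apply/in_barP => /=.
    split; first exact: H1.
    have [->|/H3/(valid_le va)//] := eqVneq w.1 0; first by rewrite addr0.
  (* The two error vectors are linked: applying t to t e - f = w gives - t f = w.1 *: E2, since t^2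
     = 0. *)
  have w0 : w'.2 = - w.1.
    have := indep _ _ Fw''; rewrite /= scalerDl addrA -w'E -(tcomb _ _ Fw) -wE.
    rewrite (linB tL) tt sub0r subrr => /(_ erefl) [_ /eqP].
    by rewrite addr_eq0 => /eqP.
  (* When level c contains the generator [E1], adding a multiple of it to the lift of e cancels w.2.
     The remaining error is absorbed by the lift of f, which requires it to lie in level d. *)
  pose p1 := if le_end c al.1 then - w.2 else 0.
  have Fp : in_bar al c (p1, 0).
    by apply/in_barP; rewrite /p1 /= eqxx; split=> //; case: ifP => //; rewrite eqxx.
  have [m1 m1E] := inE _ _ Fp; move: m1E; rewrite /= scale0r addr0 => m1E.
  have Fd : in_bar al d (w.1, w.2 + p1).
    have /in_barP[_ H2] := Fw'; have /in_barP[H3 H4] := Fw; apply/in_barP => /=; split.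
      have [H _] := noncross_finite ncr.
      by move=> w1; apply: H (H3 w1) (H2 _); rewrite w0 oppr_eq0.
    rewrite /p1; case: ifP => H5; first by rewrite subrr eqxx.
    have [_ H] := noncross_finite ncr.
    by rewrite addr0 => /H4; apply: H; rewrite H5.
  have [m2 m2E] := inE _ _ Fd.
  have tA : t (k _ e0 + p1 *: E1) = k _ f0 + (w.1 *: E1 + (w.2 + p1) *: E2).
    have := tcomb _ _ Fp; rewrite /= scale0r addr0 (linD tL) => ->.
    by rewrite scalerDl (addrA (w.1 *: E1)) -wE addrA (addrC (k _ f0)) subrK.
  apply: (@split_criterion _ _ _ _ _ _ _ _ (k _ e0 + p1 *: E1)
            (k _ f0 + (w.1 *: E1 + (w.2 + p1) *: E2)) mN rk tL hg).
  - by rewrite -tA -m1E -(linD (kL _)) tt.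
  - exists (f0 + f _ m2); rewrite (linD (kL _)) m2E (linD (gL _)) gf addr0 f0E f1E.
    by [].
  - split=> //; exists (e0 + f _ m1).
    by rewrite (linD (kL _)) m1E (linD (gL _)) gf addr0 e0E e1E.
(* Apply t to the error of t f = 0: the result is w'.1 *: E2, and it vanishes because t^2 = 0. *)
have w10 : w'.1 = 0.
  have Fw'' : in_bar al (d + 1) (0, w'.1).
    have /in_barP[H1 _] := Fw'; apply/in_barP => /=; rewrite eqxx; split=> // /H1.
    exact: valid_le.
  have := indep _ _ Fw''; rewrite /= scale0r add0r -(tcomb _ _ Fw') -w'E tt.
  by move=> /(_ erefl) [].
case: al va ncr mM MF FM HE Fw' tcomb kerE inE indep => [[a|] b] va ncr mM MF FM /= HE Fw' tcomb kerE inE indep.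
  left; have [tE1 _] := HE.
  (* If d <= a, the lift of f can be changed by a multiple of [E1], and t E1 = E2 cancels the error.
     If a < d, non-crossing gives b <= d, so there is no error in degree d + 1. *)
  pose q1 := if d <= a then - w'.2 else 0.
  have Fp : in_bar (Some a, b) d (q1, 0).
    by apply/in_barP; rewrite /q1 /= eqxx; split=> //; case: ifP => //; rewrite eqxx.
  have [m mE] := inE _ _ Fp; move: mE; rewrite /= scale0r addr0 => mE.
  apply: (@split_criterion _ _ _ _ _ _ _ _ 0 (k _ f0 + q1 *: E1) mN rk tL hg) => //.
    rewrite (linD tL) w'E w10 scale0r add0r (linZ tL) tE1 -scalerDl.
    rewrite /q1; case: ifP => da; first by rewrite subrr scale0r.
    have /in_barP[_ /= H] := Fw'; rewrite addr0.
    have /eqP-> : w'.2 == 0; last by rewrite scale0r.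
    by apply/negPn/negP => /H; move: ncr; rewrite /cross /=; lia.
  exists (f0 + f _ m); rewrite (linD (kL _)) mE (linD (gL _)) gf addr0 f0E f1E.
  by [].
have [w20|w20] := eqVneq w'.2 0.
  left; apply: (@split_criterion _ _ _ _ _ _ _ _ 0 (k _ f0) mN rk tL hg) => //.
    by rewrite w'E w10 w20 !scale0r addr0.
  by exists f0; rewrite f0E.
right; apply: (rank2_indec (A0 := k _ f0) (B0 := E2) cE tL rk).
  move=> n v.
  have /in_barP[/= H1 H2] := FN n (g n v).
  have [u [uE guE]] := hom_part f0 rk rN hg H2.
  have [|w [_ wE]] := kerE n (v - u).
    rewrite (linB (gL n)); apply: NInj; rewrite (linB (NI n)) guE f0E f1E.
    rewrite (lin0 (NI n)); apply: CC2_eq => /=.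
      by rewrite [_ *: 0]mulr0 subr0; apply/eqP/negPn/negP => /H1.
    by rewrite [_ *: 1]mulr1 subrr.
  exists (iN n (g n v)).2, w.2; rewrite -uE -(linB (kL n)) wE HE scaler0 add0r subrr.
  by [].
exists d, f0 => /(f_equal (k _)); rewrite kx w'E (lin0 (kL _)) => /(indep _ _ Fw').
by move=> w'0; move: w20; rewrite w'0 eqxx.
Qed.

Lemma noncross_compatible al be M N : valid_arc al -> valid_arc be ->
  ~~ cross al be -> ~~ cross be al -> has_model al M -> has_model be N ->
  almost_compatible M N.
Proof.
move=> va vb c1 c2 mM mN; right; split=> E f g cfl ns.
  by have [] := noncross_extension va vb c1 mM mN cfl.
by have [] := noncross_extension vb va c2 mN mM cfl.
Qed.

Lemma cross_not_compatible al be M N : cross al be -> has_model al M -> has_model be N ->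
  ~ almost_compatible M N.
Proof.
case: al be => [a b] [c d] /orP[/andP[/andP[ac cb] bd]|/andP[/andP[ca ad] db]] mM mN.
  case: c ac cb mN => [c|] ac cb mN; last by case: (a) ac.
  exact: (crossing_not_compatible ac cb bd mM mN).
move=> /almost_compatible_sym; case: a ca ad mM => [a|] ca ad mM; last by case: (c) ca.
exact: (crossing_not_compatible ca ad db mN mM).
Qed.

Lemma cross_sym al be : cross al be -> cross be al.
Proof. by case: al be => [a b] [c d]; rewrite /cross orbC. Qed.

Lemma cross_irrefl al : ~~ cross al al.
Proof. by case: al => a b; rewrite /cross ltxx !andbF. Qed.

(** * Maximality *)

(** A bound on the rank over C[y], stated degreewise so that no ambient space has to be chosen. It
    is the induction measure for splitting off bars. *)
Definition rank_le (M : GrData) (d : nat) : Prop :=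
  forall n (v : 'I_d.+1 -> gV M n), dependent v.

Lemma exists_rank M : C2obj M -> exists d, rank_le M d.
Proof.
move=> cM; have [V [t [i [gs [[iL iI _ _] _ _ gsT]]]]] := exists_rep cM.
exists (size gs) => n v.
have [a [a0 Ea]] := @spanned_dependent V gs _ (fun j => i n (v j)) (ltnSn _) (fun j => gsT _).
exists a; split=> //; apply: iI.
by rewrite (lin_sum (iL n)) Ea (lin0 (iL n)).
Qed.

(** Add one nonzero element of Z to the given elements of K, all moved to a common degree. In a
    relation between them the coefficient at Z vanishes, so the nonzero coefficient belongs to K. *)
Lemma rank_drop M Z K d : C2obj Z -> C2obj K -> ~ is_zero Z -> iso M (dsum Z K) ->
  rank_le M d.+1 -> rank_le K d.
Proof.
move=> cZ cK nZ [f [g [hf hg gf fg]]] rM n v.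
have [gZ _ _] := cZ; have [gK _ _] := cK.
have [V [t [k [_ [rk _ _ _]]]]] := exists_rep (dsum_C2 cZ cK).
have [m [z z0]] := nonzero_elt nZ.
have rZ := rep_comp rk (hom_inl Z gK) (@hinl_inj Z K).
have rK := rep_comp rk (hom_inr K gZ) (@hinr_inj Z K).
pose q := Num.min n m.
have [|z' zE] := @rep_down _ _ _ _ rZ q m z; first by lia.
have vd j : exists u : gV K q, k _ (hinr Z u) = k _ (hinr Z (v j)).
  by apply: (rep_down rK); lia.
pose v' j := proj1_sig (constructive_indefinite_description _ (vd j)).
have v'E j : k _ (hinr Z (v' j)) = k _ (hinr Z (v j)).
  by rewrite /v'; case: constructive_indefinite_description.
have [a [a0 Ea]] := rM q (fun i => g q (if unlift ord0 i is Some j then hinr Z (v' j) else hinl K z')).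
have [gL _ _] := hg; have [lL _ _] := hom_inl Z gK; have [rL _ _] := hom_inr K gZ.
have [kLZ kIZ _ _] := rZ; have [kLK kIK _ _] := rK.
move: Ea; rewrite -(lin_sum (gL q)) -[RHS](lin0 (gL q)) => /(can_inj (fg q)).
rewrite big_ord_recl unlift_none /=.
under eq_bigr => i _ do rewrite liftK /=.
rewrite -(linZ (lL q)) -(lin_sum (rL q)) => -[].
rewrite addr0 add0r => /eqP; rewrite scaler_eq0 => /orP[/eqP c0|/eqP z'0]; last first.
  by case: z0; apply: kIZ; rewrite -zE z'0 !(lin0 (kLZ _)).
move=> Ea; exists (fun j => a (lift ord0 j)); split.
  case: a0 => i; case: (unliftP ord0 i) => [j ->|-> /eqP //]; by exists j.
apply: kIK; rewrite (lin_sum (kLK n)) (lin0 (kLK n)).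
under eq_bigr => i _ do rewrite -v'E.
by rewrite -(lin_sum (kLK q)) Ea (lin0 (kLK q)).
Qed.

Lemma zero_iso M N : C2obj M -> C2obj N -> is_zero M -> is_zero N -> iso M N.
Proof.
move=> [[mx my _ _] _ _] [[nx ny _ _] _ _] M0 N0.
exists (fun n v => 0), (fun n v => 0); split=> [||n v|n v]; rewrite ?(M0 _ v) ?(N0 _ v) //.
  split=> [n a u v|n v|n v]; first by rewrite scaler0 addr0.
    by rewrite (lin0 (nx _)).
  by rewrite (lin0 (ny _)).
split=> [n a u v|n v|n v]; first by rewrite scaler0 addr0.
  by rewrite (lin0 (mx _)).
by rewrite (lin0 (my _)).
Qed.

(** * Subcategories and their indecomposable objects *)

Lemma subcategory_zero A M : subcategory A -> C2obj M -> is_zero M -> A M.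
Proof.
move=> [AC [Z [AZ Z0]] Aiso _ _] cM M0.
by apply: (Aiso Z) => //; apply: zero_iso => //; exact: AC.
Qed.

Lemma subcategory_summand A Z X : subcategory A -> C2obj Z -> A X -> summand Z X -> A Z.
Proof.
move=> [AC _ _ _ As] cZ AX sZ; have [gZ _ _] := cZ.
have [K [cK XK]] := summand_split gZ (AC _ AX) sZ.
by have [] := As _ _ _ AX cZ cK XK.
Qed.

(** Split off a bar. If it lies in A, its complement does not, since A is closed under direct sums,
    and the complement has smaller rank. *)
Lemma exists_indec_summand A M : subcategory A -> C2obj M -> ~ A M ->
  exists Z, [/\ indecomposable Z, summand Z M & ~ A Z].
Proof.
move=> sA cM; have [d] := exists_rank cM; elim: d M cM => [|d IH] M cM rM nM.
  case: nM; apply: subcategory_zero => // n v.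
  have [a [[i ai]]] := rM n (fun _ => v).
  rewrite big_ord1 => /eqP; rewrite scaler_eq0 => /orP[/eqP a0|/eqP//].
  by move: ai; rewrite (ord1 i) a0 eqxx.
have nzM : ~ is_zero M by move=> M0; apply: nM; exact: subcategory_zero.
have [al [Z [va mZ sZ]]] := exists_model_summand cM nzM.
have cZ := model_C2 mZ; have [gZ _ _] := cZ.
have [AZ|nAZ] := classic (A Z); last by exists Z; split=> //; exact: model_indec mZ.
have [K [cK MK]] := summand_split gZ cM sZ.
have rK := rank_drop cZ cK (model_nonzero mZ) MK rM.
have [|Z' [iZ' sZ' nZ']] := IH K cK rK.
  move=> AK; apply: nM; have [_ _ Aiso Asum _] := sA.
  exact: Aiso (Asum _ _ AZ AK) cM (iso_sym MK).
exists Z'; split=> //; apply: summand_trans sZ' _.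
exact: summand_trans (summand_r _ gZ) (summand_iso (iso_sym MK)).
Qed.

(* An upper bound for add (A, M) that is a subcategory by locality of endomorphism rings. *)
Definition summands_in (A : GrData -> Prop) (M X : GrData) : Prop :=
  C2obj X /\ forall Z, indecomposable Z -> summand Z X -> A Z \/ iso M Z.

Lemma summands_in_subcategory A M : subcategory A -> subcategory (summands_in A M).
Proof.
move=> sA; have [AC [Z0 [AZ0 zZ0]] Aiso Asum As] := sA; split.
- by move=> X [].
- exists Z0; split=> //; split; first exact: AC.
  by move=> Z [cZ _ _] sZ; left; exact: subcategory_summand AZ0 sZ.
- move=> X Y [cX HX] cY XY; split=> // Z iZ sZ; apply: HX => //.
  exact: summand_trans sZ (summand_iso (iso_sym XY)).
- move=> X Y [cX HX] [cY HY]; split; first exact: dsum_C2.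
  have [gX _ _] := cX; have [gY _ _] := cY.
  by move=> Z iZ /(summand_dsum iZ gX gY)[]; [exact: HX|exact: HY].
- move=> X Y Z [cX HX] cY cZ XYZ; have [gY _ _] := cY; have [gZ _ _] := cZ.
  split; split=> // W iW sW; apply: HX => //; apply: summand_trans (summand_iso (iso_sym XYZ)).
    exact: summand_trans sW (summand_l _ gZ).
  exact: summand_trans sW (summand_r _ gY).
Qed.

(** Membership in [add_with A M] is tested against the subcategory [summands_in A M], with Z as a
    summand of itself. *)
Lemma add_with_indec A M Z : subcategory A -> indecomposable M ->
  indecomposable Z -> add_with A M Z -> A Z \/ iso M Z.
Proof.
move=> sA iM iZ aZ; have [AC _ _ _ _] := sA; have [cM _ _] := iM.
have [||_] := aZ _ (summands_in_subcategory M sA).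
- move=> Y AY; split; first exact: AC.
  by move=> W [cW _ _] sW; left; exact: subcategory_summand AY sW.
- split=> // W [cW nW _] sW; right; exact: indec_summand.
by move=> /(_ Z iZ); apply; apply: summand_iso; exact: iso_refl.
Qed.

Lemma arcs_ofP A M al : subcategory A -> indecomposable M -> valid_arc al ->
  has_model al M -> arcs_of A al <-> A M.
Proof.
move=> sA iM va mM; have [cM _ _] := iM; split.
  move=> [_ [N [AN [_ /corresponds_has_model mN]]]]; have [_ _ Aiso _ _] := sA.
  exact: Aiso AN cM (model_iso mN mM).
by move=> AM; split=> //; exists M; do 2!split=> //; exact: has_model_corresponds.
Qed.

Lemma almost_rigid_noncrossing A : subcategory A ->
  almost_rigid A <-> noncrossing_set (arcs_of A).
Proof.
move=> sA; split=> [rA al be|nA M N AM AN iM iN].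
  move=> [va [M [AM [iM /corresponds_has_model mM]]]].
  move=> [vb [N [AN [iN /corresponds_has_model mN]]]].
  by apply/negP => /cross_not_compatible/(_ mM)/(_ mN); apply; exact: rA.
have [al [va mM]] := indec_has_model iM; have [be [vb mN]] := indec_has_model iN.
have Ta : arcs_of A al by apply/(arcs_ofP sA iM va mM).
have Tb : arcs_of A be by apply/(arcs_ofP sA iN vb mN).
apply: (noncross_compatible va vb) => //; exact: nA.
Qed.

Theorem theorem5p5 (A : GrData -> Prop) :
  subcategory A -> (maximal_almost_rigid A <-> triangulation (arcs_of A)).
Proof.
move=> sA; split=> [[rA maxA]|[_ ncA maxA]].
  split; first by move=> al [].
    exact/almost_rigid_noncrossing.
  move=> al va nal nc.
  have [M /corresponds_has_model mM] := exists_corresponds va.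
  have iM := model_indec mM; have [cM _ _] := iM.
  apply: (maxA M cM); first by move=> /(arcs_ofP sA iM va mM).
  (* If al crossed nothing, every indecomposable of add (A, M) would have an arc in the enlarged
     non-crossing set, so add (A, M) would be almost rigid. *)
  have arc_in Z : add_with A M Z -> indecomposable Z ->
      exists be, [/\ valid_arc be, has_model be Z & arcs_of A be \/ be = al].
    move=> aZ iZ; have [AZ|MZ] := add_with_indec sA iM iZ aZ.
      have [be [vb mZ]] := indec_has_model iZ; exists be; split=> //; left.
      by apply/(arcs_ofP sA iZ vb mZ).
    by exists al; split=> //; [exact: iso_model mM|right].
  move=> X Y aX aY iX iY.
  have [be [vb mX Tb]] := arc_in X aX iX; have [ga [vg mY Tg]] := arc_in Y aY iY.
  by apply: (noncross_compatible vb vg) => //; exact: nc.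
split; first exact/almost_rigid_noncrossing.
move=> M cM nM rM.
(* M may be decomposable and thus have no arc; an indecomposable summand outside A supplies one that
   is not in the triangulation. *)
have [Z [iZ sZ nZ]] := exists_indec_summand sA cM nM; have [cZ _ _] := iZ.
have [al [va mZ]] := indec_has_model iZ.
have aZ : add_with A M Z.
  by move=> B sB _ BM; exact: subcategory_summand BM sZ.
apply: (maxA al va); first by move=> /(arcs_ofP sA iZ va mZ).
(* Z and the objects of A all lie in the almost rigid add (A, M), so their arcs cannot cross. *)
have ncal be : arcs_of A be -> ~~ cross be al.
  move=> [vb [N [AN [iN /corresponds_has_model mN]]]].
  apply/negP => /cross_not_compatible/(_ mN)/(_ mZ); apply.
  by apply: rM => // B _ + _; apply.
move=> be ga [Tb|->] [Tg|->]; [exact: ncA|exact: ncal| |exact: cross_irrefl].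
by apply/negP => /cross_sym; apply/negP/ncal.
Qed.
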